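(* A subspace $\mathcal H_S$ of $\mathcal H$ is GAS if and only if there exists a linear function $V_K:\mathcal S(\mathcal H)\to\mathbb R_+$ such that (i) $V_K(\rho)\ge 0$, with $V_K(\rho)=0$ if and only if $\rho\in\mathcal I_S(\mathcal H)$; (ii) $V_K(\mathcal L(\rho))<0$ for all $\rho\notin\mathcal I_S(\mathcal H)$.
   Context: $\mathcal H$ is a finite-dimensional complex Hilbert space, $\mathcal B(\mathcal H)$ the linear operators on it, and $\mathcal S(\mathcal H)=\{\rho\in\mathcal B(\mathcal H):\rho\ge 0,\ \mathrm{tr}\,\rho=1\}$; $\rho$ ranges over $\mathcal S(\mathcal H)$ in (i) and (ii). Fix $C_0,\dots,C_n\in\mathcal B(\mathcal H)$ and a self-adjoint $H\in\mathcal B(\mathcal H)$, and set $\mathcal L(\rho)=-i[H,\rho]+\sum_{i=0}^n\big(C_i\rho C_i^*-\tfrac12(C_i^*C_i\rho+\rho C_i^*C_i)\big)$. For $\rho_0\in\mathcal S(\mathcal H)$ write $\hat\rho(t)=e^{t\mathcal L}\rho_0$. Let $P_S$ be the orthogonal projector onto $\mathcal H_S$ and $\mathcal I_S(\mathcal H)=\{\rho\in\mathcal S(\mathcal H):\mathrm{tr}(P_S\rho)=1\}$. $\mathcal H_S$ is called GAS if for all $\rho_0\in\mathcal S(\mathcal H)$, $\lim_{t\to\infty}\|\hat\rho(t)-P_S\hat\rho(t)P_S\|=0$. The linear function $V_K$ is understood to be extended linearly to $\mathcal B(\mathcal H)$, so that $V_K(\mathcal L(\rho))$ makes sense.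
   Formalization: GAS is taken to mean that H_S is invariant (states in I_S(H) stay in I_S(H) for all t ≥ 0) in addition to the stated limit condition; with the limit alone, the ''only if'' direction is false. *)

(* Defs.v *)
(* MathComp and MathComp-Analysis; complex numbers are R[i] for R : realType.

   The Hilbert space is C^d with its standard inner product; vectors are
   columns and operators are d x d matrices acting on the left. *)
From HB Require Import structures.
From mathcomp Require Import all_boot all_order all_algebra complex.
From mathcomp Require Import all_classical all_reals all_analysis.

Set Implicit Arguments.
Unset Strict Implicit.
Unset Printing Implicit Defensive.

Import Order.TTheory GRing.Theory Num.Theory numFieldNormedType.Exports.

Local Open Scope ring_scope.
Local Open Scope classical_set_scope.
Local Open Scope sesquilinear_scope.
Local Open Scope complex_scope.

(* R[i] with the topology of its modulus; 'M[R[i]]_d then carries the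
   entrywise topology and the max-entry norm of MathComp-Analysis. *)
HB.instance Definition _ (R : rcfType) :=
  NormedModule.copy R[i] (R[i] : numFieldType)^o.

Section Lindblad.
Context {R : realType} {d : nat}.
Local Notation C := R[i].
Implicit Types (rho : 'M[C]_d) (S : {vspace 'cV[C]_d}) (t : R).

(* In the order of C, [0 <= z] includes that z is real, so a positive
   semidefinite matrix is Hermitian. *)
Definition psdmx (A : 'M[C]_d) : Prop :=
  forall v : 'cV[C]_d, 0 <= (v^t* *m A *m v) ord0 ord0.

Definition is_state rho : Prop := psdmx rho /\ \tr rho = 1.

Definition is_orthoproj S (P : 'M[C]_d) : Prop :=
  [/\ P^t* = P, P *m P = P & forall v : 'cV[C]_d, v \in S <-> P *m v = v].

Definition orthoproj S : 'M[C]_d := xget 0 [set P | is_orthoproj S P].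

Lemma is_orthoproj_unique S (P Q : 'M[C]_d) :
  is_orthoproj S P -> is_orthoproj S Q -> P = Q.
Proof.
have half (A B : 'M[C]_d) : is_orthoproj S A -> is_orthoproj S B ->
    B *m A = A.
  move=> [_ AA SA] [_ _ SB]; apply/matrixP => i j.
  have /SA/SB : A *m col j A = col j A by rewrite colE mulmxA AA.
  by rewrite colE mulmxA -!colE => /colP/(_ i); rewrite [col _ _ _ _]mxE [RHS]mxE.
move=> SP SQ; have [hP _ _] := SP; have [hQ _ _] := SQ.
rewrite -(half _ _ SP SQ) -[in LHS]hP -[in LHS]hQ -map_mxM -trmx_mul.
by rewrite (half _ _ SQ SP) hQ.
Qed.

Lemma is_orthoproj_exists S : exists P, is_orthoproj S P.
Proof.
pose U : 'M[C]_(\dim S, d) := \matrix_(i, j) (vbasis S)`_i j ord0.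
pose m := \rank U.
pose B : 'M[C]_(m, d) := schmidt (row_base U).
have BU : B \is unitarymx by rewrite schmidt_unitarymx// rank_leq_col.
have BE : (B :=: U)%MS.
  apply: eqmx_trans (eq_row_base U).
  by apply: eqmx_schmidt_free; rewrite row_base_free.
have BB : B *m B^t* = 1%:M by apply/unitarymxP.
exists (B^t* *m B)^T; split.
- by rewrite trmxK trmx_mul map_mxM /= -!map_trmx trmxK -map_mx_comp
    (eq_map_mx _ (@conjCK _)) map_mx_id.
- by rewrite -trmx_mul mulmxA -(mulmxA _ B) BB mulmx1.
- move=> v.
  have -> : v \in S <-> (v^T <= U)%MS.
    split=> [vS|/submxP[a va]].
      apply/submxP; exists (\row_i coord (vbasis S) i v).
      apply/rowP => j; rewrite [in LHS](coord_vbasis vS) mxE summxE mxE.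
      by apply: eq_bigr => i _; rewrite !mxE.
    have -> : v = \sum_i a ord0 i *: (vbasis S)`_i.
      apply/colP => j; have /rowP/(_ j) := va; rewrite !mxE => ->.
      by rewrite summxE; apply: eq_bigr => i _; rewrite !mxE.
    apply: memv_suml => i _; apply: memvZ; apply: vbasis_mem.
    by apply: mem_nth; rewrite size_tuple.
  rewrite -BE; split=> [/submxP[a va]|<-].
    by apply: trmx_inj; rewrite trmx_mul trmxK va mulmxA -(mulmxA a) BB mulmx1.
  by rewrite trmx_mul trmxK mulmxA submxMl.
Qed.

Lemma orthoprojP S : is_orthoproj S (orthoproj S).
Proof. exact: xgetPex (is_orthoproj_exists S). Qed.

(* The states supported on S. *)
Definition is_supported_state S rho : Prop :=
  is_state rho /\ \tr (orthoproj S *m rho) = 1.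

Definition lindblad n (H : 'M[C]_d) (Cs : 'I_n.+1 -> 'M[C]_d) rho : 'M[C]_d :=
  - 'i *: (H *m rho - rho *m H)
  + \sum_(k < n.+1) (Cs k *m rho *m (Cs k)^t*
      - 2^-1 *: ((Cs k)^t* *m Cs k *m rho + rho *m ((Cs k)^t* *m Cs k))).

(* e^{tF} rho, as the sum of the exponential series. *)
Definition exp_flow (F : 'M[C]_d -> 'M[C]_d) t rho : 'M[C]_d :=
  limn (series (fun k => (t ^+ k / k`!%:R)%:C *: iter k F rho)).

(* All norms on 'M[C]_d are equivalent, so the choice of norm is immaterial. *)
Definition attractive (F : 'M[C]_d -> 'M[C]_d) S : Prop :=
  forall rho0, is_state rho0 ->
    `|exp_flow F t rho0
      - orthoproj S *m exp_flow F t rho0 *m orthoproj S| @[t --> +oo]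
    --> (0 : C).

Definition invariant (F : 'M[C]_d -> 'M[C]_d) S : Prop :=
  forall rho0, is_supported_state S rho0 ->
    forall t, 0 <= t -> is_supported_state S (exp_flow F t rho0).

(* Global asymptotic stability is invariance together with attractivity.
   Attractivity alone does not give a strict linear Lyapunov function: for
   H = 0 and jump operators |e2><e1| and |e0><e2| on C^3, every state tends to
   |e0><e0|, so S = span(e0, e1) is attractive, but it is not invariant.  There
   a linear V that is nonnegative on states and zero exactly on those supported
   on S has the form V(rho) = k rho_22 with k > 0, and V(F(rho)) =
   k (rho_11 - rho_22) is positive at diag(0, 9/10, 1/10). *)
Definition gas (F : 'M[C]_d -> 'M[C]_d) S : Prop :=
  invariant F S /\ attractive F S.

End Lindblad.

(* Main.v *)
(* Put [P] for the projector onto [S], [Q = 1 - P], [L] for the generator and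
   [E t] for its flow, which preserves states.

   Given [V], the forms [V] and [- V o L] are positive semidefinite with kernel
   exactly [S], so both are comparable with [tr (Q _)]; along the flow this
   gives [V' <= - c V], hence [V -> 0] and [tr (Q (E t rho)) -> 0], which
   controls the distance to the [S]-block.  A state supported on [S] has [V = 0],
   and [V] does not increase, so it remains supported on [S].

   Conversely, invariance forces [Q C_k P = 0] and [Q G P = 0], where
   [L X = G X + X G^* + sum C_k X C_k^*], so [Q L(X) Q] depends only on
   [Q X Q].  Attractivity makes the induced generator on the [Q]-block
   invertible: a linear form it annihilates is constant along the flow and
   tends to 0.  Hence there is a form [V] depending only on [Q X Q] with
   [V (L X) = - tr (Q X)].  It decreases to 0 along the flow, so it is
   nonnegative, and it vanishes on [rho] only if [tr (Q rho) = 0]. *)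
Require Import Defs.
From HB Require Import structures.
From mathcomp Require Import all_boot all_order all_algebra complex.
From mathcomp Require Import all_classical all_reals all_analysis.
From mathcomp Require Import ring lra.

Set Implicit Arguments.
Unset Strict Implicit.
Unset Printing Implicit Defensive.

Import Order.TTheory GRing.Theory Num.Theory numFieldNormedType.Exports.

Local Open Scope ring_scope.
Local Open Scope classical_set_scope.
Local Open Scope sesquilinear_scope.

(** * The exponential flow as a power series *)

Section Flow.
Local Open Scope complex_scope.
Context {R : realType} {d : nat}.
Local Notation C := R[i].
Local Notation re := (@complex.Re R).
Implicit Types (rho X : 'M[C]_d) (t : R) (F : {linear 'M[C]_d -> 'M[C]_d}).
Implicit Types (phi : {scalar 'M[C]_d}).

(** The entrywise sum norm: a linear map is bounded in it by the sum of its values on the matrix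
    units. *)
Definition norm1 X : C := \sum_i \sum_j `|X i j|.

Lemma norm1_ge0 X : 0 <= norm1 X.
Proof. by do 2!apply: sumr_ge0 => ? _; exact: normr_ge0. Qed.

Lemma norm1D X Y : norm1 (X + Y) <= norm1 X + norm1 Y.
Proof.
rewrite /norm1 -big_split; apply: ler_sum => i _ /=.
by rewrite -big_split; apply: ler_sum => j _ /=; rewrite mxE ler_normD.
Qed.

Lemma norm1Z a X : norm1 (a *: X) = `|a| * norm1 X.
Proof.
rewrite /norm1 mulr_sumr; apply: eq_bigr => i _.
by rewrite mulr_sumr; apply: eq_bigr => j _; rewrite mxE normrM.
Qed.

Lemma norm1_sum (I : finType) (X : I -> 'M[C]_d) :
  norm1 (\sum_i X i) <= \sum_i norm1 (X i).
Proof.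
elim/big_ind2 : _ => [|x y z w h1 h2|//].
  by rewrite /norm1 big1// => i _; rewrite big1// => j _; rewrite mxE normr0.
by apply: le_trans (norm1D _ _) _; exact: lerD.
Qed.

Lemma norm1_linear_bound F :
  exists2 M : C, 0 <= M & forall X, norm1 (F X) <= M * norm1 X.
Proof.
exists (\sum_i \sum_j norm1 (F (delta_mx i j))).
  by do 2!apply: sumr_ge0 => ? _; exact: norm1_ge0.
move=> X; rewrite [in X in X <= _](matrix_sum_delta X) linear_sum.
apply: le_trans (norm1_sum _) _; rewrite mulr_suml.
apply: ler_sum => i _; rewrite linear_sum.
apply: le_trans (norm1_sum _) _; rewrite mulr_suml.
apply: ler_sum => j _; rewrite linearZ norm1Z mulrC.
apply: ler_wpM2l; first exact: norm1_ge0.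
rewrite /norm1 (bigD1 i)//= (bigD1 j)//= -addrA lerDl.
by rewrite addr_ge0// ?sumr_ge0// => k _; rewrite sumr_ge0.
Qed.

Lemma scalar_bound phi :
  exists2 M : C, 0 <= M & forall X, `|phi X| <= M * norm1 X.
Proof.
exists (\sum_i \sum_j `|phi (delta_mx i j)|).
  by do 2!apply: sumr_ge0 => ? _; exact: normr_ge0.
move=> X; rewrite [in X in X <= _](matrix_sum_delta X) linear_sum.
apply: le_trans (ler_norm_sum _ _ _) _; rewrite mulr_suml.
apply: ler_sum => i _; rewrite linear_sum.
apply: le_trans (ler_norm_sum _ _ _) _; rewrite mulr_suml.
apply: ler_sum => j _; rewrite linearZ normrM mulrC.
apply: ler_wpM2l => //.
rewrite /norm1 (bigD1 i)//= (bigD1 j)//= -addrA lerDl.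
by rewrite addr_ge0// ?sumr_ge0// => k _; rewrite sumr_ge0.
Qed.

Lemma ler_mx_norm_entry X i j : `|X i j| <= `|X|.
Proof.
rewrite [leRHS]/Num.norm/= mx_normE -[leLHS]nngE num_le.
exact: (le_bigmax _ _ (i, j)).
Qed.

Lemma ltr_mx_norm X e : 0 < e -> (forall i j, `|X i j| < e) -> `|X| < e.
Proof.
move=> e0 hX; have : ball 0 e X.
  by split=> // i j; rewrite /ball/= mxE sub0r normrN.
by rewrite mx_norm_ball /ball_/= sub0r normrN.
Qed.

Lemma norm1_le_norm X : norm1 X <= (d * d)%:R * `|X|.
Proof.
rewrite /norm1 (le_trans (y := \sum_(i < d) \sum_(j < d) `|X|))//.
  by apply: ler_sum => i _; apply: ler_sum => j _; exact: ler_mx_norm_entry.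
by rewrite !sumr_const card_ord -mulrnA mulr_natl.
Qed.

(** Taylor coefficients at 0 of the real function [t -> re (phi (e^{tF} rho))]. Passing to
    real-valued functionals makes the theory of real power series available. *)
Definition flow_coeff F phi rho (k : nat) : R :=
  re (phi (iter k F rho)) / k`!%:R.

Lemma reD (x y : C) : re (x + y) = re x + re y.
Proof. by case: x y => [? ?] []. Qed.

Lemma reN (x : C) : re (- x) = - re x.
Proof. by case: x. Qed.

Lemma imB (x y : C) : complex.Im (x - y) = complex.Im x - complex.Im y.
Proof. by case: x y => [? ?] []. Qed.

Lemma reMr (a : R) (x : C) : re (a%:C * x) = a * re x.
Proof. by case: x => x y /=; rewrite mul0r subr0. Qed.

(** Each application of [F] costs at most a factor [M]. This geometric growth allows comparison with
    the exponential series, so the radius of convergence is infinite. *)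
Lemma flow_coeff_bound F phi rho : exists B M : R, [/\ 0 <= B, 0 <= M &
  forall k, `|re (phi (iter k F rho))| <= B * M ^+ k].
Proof.
have [M M0 HM] := norm1_linear_bound F.
have [B B0 HB] := scalar_bound phi.
have : exists2 m : R, 0 <= m & M = m%:C.
  by exists (re M); [move: M0; rewrite lecE => /andP[]|rewrite RRe_real// ger0_real].
move=> [m m0 ME].
have : exists2 b : R, 0 <= b & B * norm1 rho = b%:C.
  have h : 0 <= B * norm1 rho by rewrite mulr_ge0// norm1_ge0.
  exists (re (B * norm1 rho)); first by move: h; rewrite lecE => /andP[].
  by rewrite RRe_real// ger0_real.
move=> [b b0 bE]; exists b, m; split => // k.
rewrite -lecR rmorphM rmorphXn/= -ME -bE.
apply: le_trans (normc_ge_Re _) _; apply: le_trans (HB _) _.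
rewrite -mulrA ler_wpM2l//.
elim: k => [|k IH]; first by rewrite expr0 mulr1.
rewrite iterS (le_trans (HM _))// exprS mulrCA ler_wpM2l//.
Qed.

Lemma is_cvg_flow_coeff F phi rho x : cvgn (pseries (flow_coeff F phi rho) x).
Proof.
have [B [M [B0 M0 H]]] := flow_coeff_bound F phi rho.
apply: normed_cvg.
apply: (@series_le_cvg _ _ (fun k => B * exp_coeff (M * `|x|) k)).
- by move=> n; exact: normr_ge0.
- by move=> n; rewrite /exp_coeff/= !mulr_ge0// ?invr_ge0// exprn_ge0// mulr_ge0.
- move=> n; rewrite /flow_coeff/exp_coeff/= !normrM normrX exprMn.
  rewrite (ger0_norm (_ : 0 <= n`!%:R^-1)) ?invr_ge0//.
  have -> : B * (M ^+ n * `|x| ^+ n / n`!%:R) = B * M ^+ n / n`!%:R * `|x| ^+ n.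
    by rewrite !mulrA [LHS]mulrAC.
  by rewrite ler_wpM2r ?exprn_ge0// ler_wpM2r ?invr_ge0.
- rewrite (_ : series _ = B *: series (exp_coeff (M * `|x|))).
    by apply: is_cvgZr; exact: is_cvg_series_exp_coeff.
  by apply/funext => n; rewrite /series/= fctE scaler_sumr.
Qed.

(** Termwise differentiation shifts the index by one, and the extra [F] is absorbed into the
    functional. This is where the flow equation comes from. *)
Lemma flow_coeff_diffs F phi rho :
  pseries_diffs (flow_coeff F phi rho) = flow_coeff F (phi \o F) rho.
Proof.
apply/funext => k; rewrite /pseries_diffs /flow_coeff /= factS natrM invfM.
by rewrite mulrCA mulVKf// pnatr_eq0.
Qed.

Lemma is_derive_pseries_flow F phi rho x :
  is_derive x (1 : R) (fun x => limn (pseries (flow_coeff F phi rho) x))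
    (limn (pseries (flow_coeff F (phi \o F) rho) x)).
Proof.
rewrite -flow_coeff_diffs.
(* Any radius beyond the modulus of [x] serves, as the series converges everywhere. *)
apply: (@pseries_snd_diffs _ _ (`|x| + 1)); rewrite ?flow_coeff_diffs;
  do ?exact: is_cvg_flow_coeff.
by rewrite (ger0_norm (_ : 0 <= `|x| + 1)) ?addr_ge0// ltrDl.
Qed.

Lemma imD (x y : C) : complex.Im (x + y) = complex.Im x + complex.Im y.
Proof. by case: x y => [? ?] []. Qed.

Lemma imMr (a : R) (x : C) : complex.Im (a%:C * x) = a * complex.Im x.
Proof. by case: x => x y /=; rewrite mul0r addr0. Qed.

(** Statements about real parts of functionals are transferred to imaginary parts by multiplying the
    functional by [- 'i]. *)
Lemma re_iM (z : C) : re (- 'i * z) = complex.Im z.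
Proof.
by rewrite -complexiE; case: z => x y /=; rewrite oppr0 mul0r sub0r mulN1r opprK.
Qed.

Lemma normc_real (a : R) : `|a%:C| = `|a|%:C.
Proof. by rewrite normc_def/= expr0n addr0 sqrtr_sqr. Qed.

Lemma normc_le_reim (z : C) : `|z| <= (`|re z| + `|complex.Im z|)%:C.
Proof.
rewrite {1}(complexE z) (le_trans (ler_normD _ _))// rmorphD/= -!normc_real.
by rewrite normrM complexiE normCi mul1r.
Qed.

Lemma cvg_mx_entries (f : nat -> 'M[C]_d) X :
  (forall i j, (fun k => re (f k i j)) @ \oo --> re (X i j)) ->
  (forall i j, (fun k => complex.Im (f k i j)) @ \oo --> complex.Im (X i j)) ->
  f @ \oo --> X.
Proof.
move=> hre him; apply/cvgrPdist_lt => e e0.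
have [e' e'0 ->] : exists2 e' : R, 0 < e' & e = e'%:C.
  exists (re e); last by rewrite RRe_real// gtr0_real.
  by move: e0; rewrite ltcE => /andP[].
have h : \forall k \near \oo, forall ij : 'I_d * 'I_d,
    `|X ij.1 ij.2 - f k ij.1 ij.2| < e'%:C.
  apply: filter_forall => -[i j] /=.
  have e2 : 0 < e' / 2 by rewrite divr_gt0.
  have /cvgrPdist_lt/(_ _ e2) h1 := hre i j.
  have /cvgrPdist_lt/(_ _ e2) h2 := him i j.
  near=> k.
  rewrite (le_lt_trans (normc_le_reim _))// ltcR (splitr e') ltrD//.
    by rewrite reD reN; near: k.
  by rewrite imB; near: k.
near=> k.
have k_ij : forall ij : 'I_d * 'I_d, `|X ij.1 ij.2 - f k ij.1 ij.2| < e'%:C.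
  by near: k.
apply: ltr_mx_norm => [|i j]; first by rewrite ltcR.
by rewrite !mxE; exact: (k_ij (i, j)).
Unshelve. all: by end_near. Qed.

Lemma cvg_scalar (f : nat -> 'M[C]_d) X phi :
  f @ \oo --> X -> (fun k => re (phi (f k))) @ \oo --> re (phi X).
Proof.
have [M M0 HM] := scalar_bound phi.
move=> fX; apply/cvgrPdist_lt => e e0.
(* [M * (d * d)%:R] bounds [phi] with respect to the max norm; the added 1 makes division by [K]
   legitimate. *)
pose K : C := 1 + M * (d * d)%:R.
have K0 : 0 < K by rewrite ltr_pwDl// mulr_ge0.
have eK : 0 < e%:C / K by rewrite divr_gt0// ltcR.
have /cvgrPdist_lt/(_ _ eK) h := fX.
near=> k.
rewrite -reN -reD -linearN -linearD -ltcR.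
rewrite (le_lt_trans (normc_ge_Re _))// (le_lt_trans (HM _))//.
rewrite (le_lt_trans (ler_wpM2l M0 (norm1_le_norm _)))// mulrA.
rewrite (le_lt_trans (y := K * `|X - f k|))//; first by rewrite ler_wpM2r// lerDr.
by rewrite mulrC -ltr_pdivlMr//; near: k.
Unshelve. all: by end_near. Qed.

(** The trace pairing: every linear form on matrices is some [trform A], so forms can be handled
    through their matrices. *)
Definition trform (A X : 'M[C]_d) : C := \tr (A *m X).

Fact trform_is_linear A : scalar (trform A).
Proof.
move=> a X Y; rewrite /trform mulmxDr mxtraceD -scalemxAr mxtraceZ.
by [].
Qed.

HB.instance Definition _ A :=
  GRing.isLinear.Build C 'M[C]_d C _ (trform A) (trform_is_linear A).

Lemma trformZ a A X : trform (a *: A) X = a * trform A X.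
Proof. by rewrite /trform -scalemxAl mxtraceZ. Qed.

Lemma trformB A X Y : trform A (X - Y) = trform A X - trform A Y.
Proof. exact: linearB. Qed.

Lemma trform_delta a i j X : trform (a *: delta_mx j i) X = a * X i j.
Proof.
rewrite /trform -scalemxAl mxtraceZ; congr (_ * _).
rewrite /mxtrace (bigD1 j)//= mxE (bigD1 i)//= mxE !eqxx mul1r.
rewrite big1 ?addr0 => [|k ki]; last by rewrite mxE (negbTE ki) andbF mul0r.
rewrite big1 ?addr0// => k kj; rewrite mxE big1// => l _.
by rewrite mxE (negbTE kj) mul0r.
Qed.

Lemma re_scalar_series F phi rho t n :
  re (phi (series (fun k => (t ^+ k / k`!%:R)%:C *: iter k F rho) n)) =
  pseries (flow_coeff F phi rho) t n.
Proof.
rewrite /series /pseries/= /series/= linear_sum.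
elim: n => [|n IH]; first by rewrite !big_geq//= raddf0.
rewrite !big_nat_recr//= reD IH; congr (_ + _).
by rewrite linearZ/= reMr /flow_coeff mulrC mulrA mulrAC.
Qed.

(** [exp_flow] is a bare limit, so convergence of the matrix series must be shown before a
    functional can pass through it. It is obtained entry by entry. *)
Lemma exp_flow_pseries F phi rho t :
  re (phi (exp_flow F t rho)) = limn (pseries (flow_coeff F phi rho) t).
Proof.
pose s : nat -> 'M[C]_d := series (fun k => (t ^+ k / k`!%:R)%:C *: iter k F rho).
have sE (psi : {scalar 'M[C]_d}) : (fun n => re (psi (s n))) = pseries (flow_coeff F psi rho) t.
  by apply/funext => n; exact: re_scalar_series.
(* The factor [a = 1] reads off the real part of the entry at [(i, j)], and [a = - 'i] its imaginary
   part. *)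
pose L a i j := limn (pseries (flow_coeff F (trform (a *: delta_mx j i)) rho) t).
have sL : s @ \oo --> \matrix_(i, j) (L 1 i j +i* L (- 'i) i j : C).
  apply: cvg_mx_entries => i j; rewrite mxE/=.
    rewrite (_ : (fun _ => _) = fun n => re (trform (1 *: delta_mx j i) (s n))).
      by rewrite sE; exact: is_cvg_flow_coeff.
    by apply/funext => n; rewrite trform_delta mul1r.
  rewrite (_ : (fun _ => _) = fun n => re (trform (- 'i *: delta_mx j i) (s n))).
    by rewrite sE; exact: is_cvg_flow_coeff.
  by apply/funext => n; rewrite trform_delta re_iM.
have -> : exp_flow F t rho = limn s by [].
rewrite -sE; apply/esym/cvg_lim => //.
by apply: cvg_scalar; apply/cvg_ex; eexists; exact: sL.
Qed.

Lemma exp_flow0 F phi rho : re (phi (exp_flow F 0 rho)) = re (phi rho).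
Proof.
rewrite exp_flow_pseries; apply: cvg_lim => //.
(* The partial sum of index 0 is empty; the sums are constant only from index 1 on. *)
apply: cvg_near_cst; exists 1%N => // -[//|n] _.
rewrite /pseries/= /series/= big_nat_recl// big1_seq ?addr0.
  by rewrite /flow_coeff/= expr0 mulr1 divr1.
by move=> k _; rewrite expr0n/= mulr0.
Qed.

Lemma exp_flow_eq0 F phi rho t :
  (forall k, re (phi (iter k F rho)) = 0) -> re (phi (exp_flow F t rho)) = 0.
Proof.
move=> h; rewrite exp_flow_pseries; apply: cvg_lim => //.
rewrite (_ : pseries _ _ = cst 0); first exact: cvg_cst.
apply/funext => n; rewrite /pseries/= /series/= big1// => k _.
by rewrite /flow_coeff h mul0r mul0r.
Qed.

Lemma is_derive_exp_flow F phi rho t :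
  is_derive t (1 : R) (fun t => re (phi (exp_flow F t rho)))
    (re (phi (F (exp_flow F t rho)))).
Proof.
rewrite (_ : (fun _ => _) = fun x => limn (pseries (flow_coeff F phi rho) x)).
  rewrite (exp_flow_pseries F (phi \o F)); exact: is_derive_pseries_flow.
by apply/funext => x; exact: exp_flow_pseries.
Qed.

End Flow.

(** * Positive semidefinite matrices *)

Section Psd.
Context {R : realType} {d : nat}.
Local Notation C := R[i].
Implicit Types (A B X : 'M[C]_d) (x y z v : 'cV[C]_d) (a b : C).
Implicit Types (phi : {scalar 'M[C]_d}).

Lemma trmxCM m n p (A : 'M[C]_(m, n)) (B : 'M[C]_(n, p)) :
  (A *m B)^t* = B^t* *m A^t*.
Proof. by rewrite trmx_mul map_mxM. Qed.

Lemma trmxCD m n (A B : 'M[C]_(m, n)) : (A + B)^t* = A^t* + B^t*.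
Proof. by rewrite raddfD map_mxD. Qed.

Lemma trmxCB m n (A B : 'M[C]_(m, n)) : (A - B)^t* = A^t* - B^t*.
Proof. by rewrite raddfB map_mxB. Qed.

Lemma trmxCZ m n a (A : 'M[C]_(m, n)) : (a *: A)^t* = Num.conj a *: A^t*.
Proof. by rewrite linearZ map_mxZ. Qed.

Lemma trmxC_sum m n (I : finType) (A : I -> 'M[C]_(m, n)) :
  (\sum_i A i)^t* = \sum_i (A i)^t*.
Proof. by rewrite raddf_sum (raddf_sum (map_mx Num.conj)). Qed.

Lemma trmxC1 : (1%:M : 'M[C]_d)^t* = 1%:M.
Proof. by rewrite trmx1 map_mx1. Qed.

Definition sesq A x y : C := (x^t* *m A *m y) ord0 ord0.

Lemma sesqDr A x y z : sesq A x (y + z) = sesq A x y + sesq A x z.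
Proof. by rewrite /sesq mulmxDr mxE. Qed.

Lemma sesqDl A x y z : sesq A (x + y) z = sesq A x z + sesq A y z.
Proof. by rewrite /sesq trmxCD !mulmxDl mxE. Qed.

Lemma sesqZr A a x y : sesq A x (a *: y) = a * sesq A x y.
Proof. by rewrite /sesq -scalemxAr mxE. Qed.

Lemma sesqZl A a x y : sesq A (a *: x) y = Num.conj a * sesq A x y.
Proof. by rewrite /sesq trmxCZ -!scalemxAl mxE. Qed.

Lemma sesqD A B x y : sesq (A + B) x y = sesq A x y + sesq B x y.
Proof. by rewrite /sesq mulmxDr mulmxDl mxE. Qed.

Lemma sesqN A x y : sesq (- A) x y = - sesq A x y.
Proof. by rewrite /sesq mulmxN mulNmx mxE. Qed.

Lemma sesqZ a A x y : sesq (a *: A) x y = a * sesq A x y.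
Proof. by rewrite /sesq -scalemxAr -scalemxAl mxE. Qed.

Lemma sesq_sum (I : finType) (A : I -> 'M[C]_d) x y :
  sesq (\sum_i A i) x y = \sum_i sesq (A i) x y.
Proof. by rewrite /sesq mulmx_sumr mulmx_suml summxE. Qed.

Lemma sesq_conj A B x y : sesq (B^t* *m A *m B) x y = sesq A (B *m x) (B *m y).
Proof. by rewrite /sesq trmxCM !mulmxA. Qed.

Lemma sesq_adj A x y : sesq (A^t*) x y = Num.conj (sesq A y x).
Proof.
have conj00 (Z : 'M[C]_1) : Num.conj (Z ord0 ord0) = (Z^t*) ord0 ord0.
  by rewrite !mxE.
by rewrite /sesq conj00 !trmxCM trmxCK mulmxA.
Qed.

Lemma sesqE A x y : sesq A x y = \sum_i \sum_j Num.conj (x i ord0) * A i j * y j ord0.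
Proof.
rewrite /sesq mxE exchange_big; apply: eq_bigr => j _ /=.
by rewrite mxE mulr_suml; apply: eq_bigr => i _; rewrite !mxE.
Qed.

Lemma sesq_delta A i j : sesq A (delta_mx i ord0) (delta_mx j ord0) = A i j.
Proof.
rewrite /sesq -colE !mxE (bigD1 i)//= big1 ?addr0.
  by rewrite !mxE !eqxx conjC1 mul1r.
by move=> k ki; rewrite !mxE (negbTE ki) conjC0 mul0r.
Qed.

Lemma sesq_trace A x y : sesq A x y = \tr (A *m (y *m x^t*)).
Proof. by rewrite mulmxA mxtrace_mulC mulmxA /sesq /mxtrace big_ord1. Qed.

(** Polarization: the vectors [x + y] and [x + 'i *: y] together recover the off-diagonal values of
    the form. *)
Lemma sesq_polar A : (forall x, sesq A x x = 0) -> A = 0.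
Proof.
move=> h; have h2 x y : sesq A x y = 0.
  have := h (x + y); rewrite !(sesqDl, sesqDr) !h add0r addr0.
  have := h (x + 'i *: y); rewrite !(sesqDl, sesqDr, sesqZl, sesqZr) !h.
  rewrite !mulr0 add0r addr0 conjCi mulNr -mulrBr => /eqP.
  rewrite mulf_eq0 (negbTE (neq0Ci _)) subr_eq0 => /eqP <- /eqP.
  by rewrite -mulr2n mulrn_eq0/= => /eqP.
by apply/matrixP => i j; rewrite -sesq_delta h2 mxE.
Qed.

(** The quadratic form of [A] is real, hence that of [A^t* - A] vanishes, and polarization
    applies. *)
Lemma psd_herm A : psdmx A -> A^t* = A.
Proof.
move=> Ap; apply/eqP; rewrite -subr_eq0; apply/eqP; apply: sesq_polar => x.
rewrite sesqD sesqN sesq_adj; apply/eqP; rewrite subr_eq0; apply/eqP/CrealP.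
by apply: ger0_real; exact: Ap.
Qed.

Lemma psd_conj A x y : psdmx A -> sesq A x y = Num.conj (sesq A y x).
Proof. by move=> /psd_herm {1}<-; rewrite sesq_adj. Qed.

(** Cauchy-Schwarz, with a positive upper bound [M] in place of [sesq A y y] so that no degenerate
    case arises. *)
Lemma psd_cauchy A x y M : psdmx A -> 0 < M -> sesq A y y <= M ->
  `|sesq A x y| ^+ 2 <= M * sesq A x x.
Proof.
move=> Ap M0 yM; set b := sesq A x y; set p := `|b| ^+ 2.
have p0 : 0 <= p by rewrite exprn_ge0.
(* This vector minimizes the form on the line [x + C y] when [sesq A y y = M]. *)
have := Ap (x + (- (Num.conj b / M)) *: y); rewrite -/(sesq _ _ _).
have MR : Num.conj M = M by apply/CrealP/gtr0_real.
have yx : sesq A y x = Num.conj b by rewrite (psd_conj _ _ Ap).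
rewrite !(sesqDl, sesqDr, sesqZl, sesqZr) yx -/b.
rewrite rmorphN rmorphM fmorphV/= conjCK MR.
have pE : p = b * Num.conj b by rewrite /p normCK.
set E := (X in 0 <= X).
have -> : E = sesq A x x - p / M + (p / M * (sesq A y y / M) - p / M).
  by rewrite /E pE; ring.
move=> h; rewrite mulrC -ler_pdivrMr// -subr_ge0.
apply: le_trans h _; rewrite gerDl subr_le0.
by rewrite ler_piMr ?ler_pdivrMr ?mul1r// divr_ge0// ltW.
Qed.

Definition sqnorm x : C := sesq 1%:M x x.

Lemma sqnormE x : sqnorm x = \sum_i `|x i ord0| ^+ 2.
Proof.
rewrite /sqnorm /sesq mulmx1 mxE; apply: eq_bigr => i _.
by rewrite !mxE normCKC.
Qed.

Lemma sqnorm_ge0 x : 0 <= sqnorm x.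
Proof. by rewrite sqnormE sumr_ge0// => i _; rewrite exprn_ge0. Qed.

Lemma sqnorm_eq0 x : sqnorm x = 0 -> x = 0.
Proof.
rewrite sqnormE => /eqP; rewrite psumr_eq0 => [/allP h|i _]; last first.
  by rewrite exprn_ge0.
apply/colP => i; rewrite mxE; apply/eqP.
by have := h i (mem_index_enum _); rewrite /= sqrf_eq0 normr_eq0.
Qed.

Lemma sesq_bound A a x : (forall i j, `|A i j| <= a) ->
  `|sesq A x x| <= d%:R * a * sqnorm x.
Proof.
move=> hA.
have h i j : `|x i ord0| * `|x j ord0| <= (`|x i ord0| ^+ 2 + `|x j ord0| ^+ 2) / 2.
  rewrite ler_pdivlMr// -subr_ge0.
  have -> : `|x i ord0| ^+ 2 + `|x j ord0| ^+ 2 - `|x i ord0| * `|x j ord0| * 2 =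
    (`|x i ord0| - `|x j ord0|) ^+ 2 by ring.
  by rewrite real_exprn_even_ge0// rpredB// normr_real.
rewrite sesqE (le_trans (ler_norm_sum _ _ _))//.
apply: (@le_trans _ _ (\sum_i \sum_j a * ((`|x i ord0| ^+ 2 + `|x j ord0| ^+ 2) / 2))).
  apply: ler_sum => i _; rewrite (le_trans (ler_norm_sum _ _ _))//.
  apply: ler_sum => j _; rewrite !normrM norm_conjC mulrAC mulrC.
  by rewrite ler_pM// mulr_ge0.
rewrite le_eqVlt; apply/orP; left; apply/eqP.
under eq_bigr do rewrite -mulr_sumr -mulr_suml big_split/= sumr_const card_ord -sqnormE.
rewrite -mulr_sumr -mulr_suml big_split/= sumr_const card_ord sumrMnl -sqnormE.
by rewrite -[_ *+ d]mulr_natl; field.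
Qed.

Lemma entries_bound A : exists2 a : C, 0 < a & forall i j, `|A i j| <= a.
Proof.
exists (1 + \sum_i \sum_j `|A i j|).
  by rewrite ltr_pwDl// sumr_ge0// => i _; rewrite sumr_ge0.
move=> i j; rewrite (bigD1 i)//= (bigD1 j)//=.
rewrite addrCA -!addrA lerDl !addr_ge0// ?sumr_ge0// => k _.
by rewrite sumr_ge0.
Qed.

Lemma psd_outer x : psdmx (x *m x^t*).
Proof.
move=> v; rewrite mulmxA -mulmxA.
have -> : x^t* *m v = (v^t* *m x)^t* by rewrite trmxCM trmxCK.
by rewrite mxE big_ord1 !mxE mul_conjC_ge0.
Qed.

(** Spectral theorem: [A] is normal, its eigenvalues are values of its quadratic form, and the
    adjoint rows of the unitary matrix are eigenvectors. Positivity of a linear form can then be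
    tested on rank-one matrices. *)
Lemma psd_sum_outer A : psdmx A ->
  exists (D : 'I_d -> C) (w : 'I_d -> 'cV[C]_d),
    (forall i, 0 <= D i) /\ A = \sum_i D i *: (w i *m (w i)^t*).
Proof.
move=> Ap.
have AN : A \is normalmx by apply/normalmxP; rewrite psd_herm.
have /orthomx_spectralP AE := AN.
set U := spectralmx A in AE; set D := spectral_diag A in AE.
have UU : U \is unitarymx by exact: spectral_unitarymx.
have UUt := unitarymxP UU; rewrite invmx_unitary// in AE.
have DE : diag_mx D = U *m A *m U^t*.
  by rewrite [in RHS]AE !mulmxA UUt mul1mx -mulmxA UUt mulmx1.
exists (D ord0), (fun i => (row i U)^t*); split.
  move=> i; have -> : D ord0 i = (diag_mx D) i i by rewrite mxE eqxx.
  rewrite DE -sesq_delta.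
  have -> : U *m A *m U^t* = (U^t*)^t* *m A *m U^t* by rewrite trmxCK.
  by rewrite sesq_conj; exact: Ap.
rewrite [in LHS]AE; apply/matrixP => i j; rewrite summxE -mulmxA mxE.
apply: eq_bigr => k _; rewrite mul_diag_mx trmxCK !mxE.
rewrite big_ord1 !mxE; ring.
Qed.

Lemma psd_scalar_ge0 phi : (forall x, 0 <= phi (x *m x^t*)) ->
  forall A, psdmx A -> 0 <= phi A.
Proof.
move=> h A /psd_sum_outer[D [w [D0 ->]]]; rewrite linear_sum sumr_ge0// => i _.
by rewrite linearZ mulr_ge0.
Qed.

Lemma scalar_trform phi : exists K, forall X, phi X = trform K X.
Proof.
exists (\matrix_(i, j) phi (delta_mx j i)) => X.
rewrite [in LHS](matrix_sum_delta X) linear_sum /trform /mxtrace.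
under [RHS]eq_bigr do rewrite mxE.
rewrite [RHS]exchange_big/=; apply: eq_bigr => i _.
rewrite linear_sum; apply: eq_bigr => j _.
by rewrite linearZ mxE mulrC.
Qed.

Lemma psd_trace_ge0 A B : psdmx A -> psdmx B -> 0 <= \tr (A *m B).
Proof.
move=> Ap; apply: (psd_scalar_ge0 (phi := trform A)) => x.
by have := Ap x; rewrite -/(sesq A x x) sesq_trace.
Qed.

Lemma psd_scale_sub_trace a A B X : psdmx (a *: A - B) -> psdmx X ->
  \tr (B *m X) <= a * \tr (A *m X).
Proof.
move=> ABp Xp; have := psd_trace_ge0 ABp Xp.
by rewrite mulmxBl raddfB/= -scalemxAl mxtraceZ subr_ge0.
Qed.

Lemma psd_entry_ge0 A i : psdmx A -> 0 <= A i i.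
Proof. by move=> Ap; rewrite -sesq_delta; exact: Ap. Qed.

Lemma psd_tr_ge0 A : psdmx A -> 0 <= \tr A.
Proof. by move=> Ap; rewrite sumr_ge0// => i _; exact: psd_entry_ge0. Qed.

Lemma psd_conjmx A B : psdmx A -> psdmx (B *m A *m B^t*).
Proof.
move=> Ap x; have -> : B *m A *m B^t* = (B^t*)^t* *m A *m B^t* by rewrite trmxCK.
by rewrite -/(sesq _ _ _) sesq_conj; exact: Ap.
Qed.

Lemma psdD A B : psdmx A -> psdmx B -> psdmx (A + B).
Proof. by move=> Ap Bp x; rewrite -/(sesq _ _ _) sesqD addr_ge0//; [exact: Ap|exact: Bp]. Qed.

Lemma psdZ a A : 0 <= a -> psdmx A -> psdmx (a *: A).
Proof. by move=> a0 Ap x; rewrite -/(sesq _ _ _) sesqZ mulr_ge0//; exact: Ap. Qed.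

Lemma psd_sum (I : finType) (A : I -> 'M[C]_d) :
  (forall i, psdmx (A i)) -> psdmx (\sum_i A i).
Proof.
move=> Ap x; rewrite -/(sesq _ _ _) sesq_sum sumr_ge0// => i _; exact: Ap.
Qed.

Lemma psd1 : psdmx (1%:M : 'M[C]_d).
Proof. by move=> x; exact: sqnorm_ge0. Qed.

Lemma psd_row_bound A M x i : psdmx A -> 0 < M -> A i i <= M ->
  `|(A *m x) i ord0| ^+ 2 <= M * sesq A x x.
Proof.
move=> Ap M0 AM.
have -> : (A *m x) i ord0 = sesq A (delta_mx i ord0) x.
  by rewrite /sesq trmx_delta map_delta_mx -mulmxA -rowE [RHS]mxE.
rewrite (psd_conj _ _ Ap) norm_conjC.
by apply: psd_cauchy => //; rewrite sesq_delta.
Qed.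

Lemma psd_ker A x : psdmx A -> sesq A x x = 0 -> A *m x = 0.
Proof.
move=> Ap x0; have [M M0 HM] := entries_bound A.
apply/colP => i; rewrite [RHS]mxE; apply/eqP.
rewrite -normr_eq0 -sqrf_eq0 eq_le exprn_ge0// andbT.
rewrite (le_trans (psd_row_bound x Ap M0 _))// ?x0 ?mulr0//.
by rewrite (le_trans _ (HM i i))// real_ler_norm// ger0_real// psd_entry_ge0.
Qed.

Lemma mul0_col A B : (forall x, A *m (B *m x) = 0) -> A *m B = 0.
Proof.
move=> h; apply/matrixP => i j; rewrite [RHS]mxE.
have := h (delta_mx j ord0); rewrite mulmxA -colE => /colP/(_ i).
by rewrite !mxE.
Qed.

Lemma sqnorm_mul A x : sqnorm (A *m x) = sesq (A^t* *m A) x x.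
Proof. by rewrite /sqnorm -sesq_conj mulmx1. Qed.

Lemma sesq_proj Q x : Q^t* = Q -> Q *m Q = Q -> sesq Q x x = sqnorm (Q *m x).
Proof.
by move=> Qh QQ; rewrite sqnorm_mul Qh QQ.
Qed.

(** The kernel inclusion gives [Q = D A], so [|Q x|^2] is bounded by a multiple of [|A x|^2], which
    Cauchy-Schwarz on each row bounds by a multiple of [sesq A x x]. *)
Lemma proj_le_psd A Q : Q^t* = Q -> Q *m Q = Q -> psdmx A ->
  (forall x, A *m x = 0 -> Q *m x = 0) ->
  exists2 c, 0 < c & psdmx (c *: A - Q).
Proof.
move=> Qh QQ Ap AQ.
(* Inclusion of row spaces is dual to inclusion of kernels: the columns of the cokernel matrix of
   [A] are killed by [A], hence by [Q]. *)
have /submxP[D DE] : (Q <= A)%MS.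
  rewrite submxE; apply/eqP/mul0_col => x; apply: AQ.
  by rewrite mulmxA mulmx_coker mul0mx.
have [M M0 HM] := entries_bound A.
have [b b0 Hb] := entries_bound (D^t* *m D).
(* [d%:R * b] bounds the form of [D^t* *m D] and [d%:R * M] bounds [|A x|^2] against the form of
   [A]; the 1 ensures positivity. *)
exists (d%:R * b * (d%:R * M) + 1); first by rewrite ltr_pwDr// !mulr_ge0// ltW.
move=> x; rewrite -/(sesq _ _ _) sesqD sesqN sesqZ subr_ge0.
rewrite sesq_proj// {1}DE -mulmxA.
rewrite sqnorm_mul.
apply: le_trans (real_ler_norm _) _.
  by apply: ger0_real; rewrite -sqnorm_mul sqnorm_ge0.
apply: le_trans (sesq_bound _ Hb) _.
have hA : sqnorm (A *m x) <= d%:R * M * sesq A x x.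
  rewrite sqnormE (le_trans (y := \sum_(i < d) M * sesq A x x))//.
    apply: ler_sum => i _; apply: psd_row_bound => //.
    by rewrite (le_trans _ (HM i i))// real_ler_norm// ger0_real// psd_entry_ge0.
  by rewrite sumr_const card_ord -mulrA mulr_natl.
rewrite mulrDl mul1r (le_trans (y := d%:R * b * (d%:R * M * sesq A x x)))//.
  by rewrite ler_wpM2l// mulr_ge0// ltW.
by rewrite mulrA lerDl; exact: Ap.
Qed.

(** The kernel inclusion gives [A = A Q], and since [A] is Hermitian [A = Q A Q]; its form at [x] is
    then bounded by a multiple of [|Q x|^2]. *)
Lemma psd_le_proj A Q : Q^t* = Q -> Q *m Q = Q -> psdmx A ->
  (forall x, Q *m x = 0 -> A *m x = 0) ->
  exists2 c, 0 < c & psdmx (c *: Q - A).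
Proof.
move=> Qh QQ Ap QA.
have AQ : A = A *m Q.
  apply/eqP; rewrite -subr_eq0 -[X in X - _]mulmx1 -mulmxBr.
  apply/eqP/mul0_col => x; apply: QA.
  by rewrite mulmxA mulmxBr mulmx1 QQ subrr mul0mx.
have QAQ : A = Q^t* *m A *m Q.
  by rewrite -mulmxA -AQ -[LHS](psd_herm Ap) {1}AQ trmxCM (psd_herm Ap).
have [b b0 Hb] := entries_bound A.
exists (d%:R * b + 1); first by rewrite ltr_pwDr// mulr_ge0// ltW.
move=> x; rewrite -/(sesq _ _ _) sesqD sesqN sesqZ subr_ge0.
rewrite {1}QAQ sesq_conj (sesq_proj x Qh QQ) mulrDl mul1r.
apply: le_trans (real_ler_norm _) _; first by apply: ger0_real; exact: Ap.
by apply: le_trans (sesq_bound _ Hb) _; rewrite lerDl sqnorm_ge0.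
Qed.

Lemma outer_tr x : \tr (x *m x^t*) = sqnorm x.
Proof. by rewrite -[x *m _]mul1mx -sesq_trace. Qed.

Lemma outer_state x : x != 0 -> is_state ((sqnorm x)^-1 *: (x *m x^t*)).
Proof.
move=> x0; have n0 : sqnorm x != 0 by apply: contra_neq x0; exact: sqnorm_eq0.
split; first by apply: psdZ; [rewrite invr_ge0 sqnorm_ge0|exact: psd_outer].
by rewrite mxtraceZ outer_tr mulVf.
Qed.

Lemma state_entry_le1 A i : is_state A -> A i i <= 1.
Proof.
move=> [Ap <-]; rewrite /mxtrace (bigD1 i)//= lerDl sumr_ge0// => j _.
exact: psd_entry_ge0.
Qed.

End Psd.

Local Open Scope complex_scope.

(** * The Lindblad flow preserves states *)

Section RealDerivatives.
Context {R : realType}.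
Implicit Types (f : R -> R) (t h : R).

Lemma is_derive_approx f t D : is_derive t 1 f D -> forall e, 0 < e ->
  \forall h \near 0^'+, `|f (t + h) - f t - h * D| <= e * h.
Proof.
move=> [df fD] e e0.
have : (fun h => h^-1 *: ((f \o shift t) (h *: (1 : R)) - f t)) @ 0^' --> D.
  by rewrite -fD; exact: df.
move=> /cvgrPdist_lt/(_ _ e0)/nbhs_ballP[r /= r0 hr].
exists r => // h /= hlt hp.
have := hr h hlt; rewrite gt_eqF// => /(_ isT).
rewrite [h *: 1]mulr1 [h + t]addrC => /ltW.
rewrite -(ler_pM2r hp); apply: le_trans.
rewrite -[X in _ <= _ * X](gtr0_norm hp) -normrM mulrBl distrC.
by rewrite [_ *: _]mulrC -mulrA mulVf ?gt_eqF// mulr1 [D * h]mulrC.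
Qed.

Lemma is_derive_right_ge0 f t D : is_derive t 1 f D ->
  (forall s, t <= s -> f t <= f s) -> 0 <= D.
Proof.
move=> df fs; rewrite leNgt; apply/negP => D0.
(* A first-order error of slope [- D / 2] still leaves a strict decrease to the right of [t]. *)
have e0 : 0 < - D / 2 by lra.
have hr := is_derive_approx df e0.
near (0 : R)^'+ => h.
have h0 : 0 < h by [].
have : `|f (t + h) - f t - h * D| <= - D / 2 * h by near: h.
have /fs h1 : t <= t + h by rewrite lerDl ltW.
rewrite ler_norml => /andP[_ h2].
have : h * D < 0 by rewrite pmulr_rlt0.
nra.
Unshelve. all: by end_near. Qed.

Lemma is_derive_nonincr f (D : R -> R) a b : a <= b ->
  (forall t, is_derive t 1 f (D t)) ->
  (forall t, a <= t -> D t <= 0) -> f b <= f a.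
Proof.
move=> ab df D0.
have cf : {within `[a, b], continuous f}.
  apply: derivable_within_continuous => x _.
  by have [] := df x.
have [c /[!in_itv]/= /andP[ac _] fE] := MVT_segment ab (fun x _ => df x) cf.
rewrite -subr_le0 fE mulr_le0_ge0 ?subr_ge0//.
exact: D0.
Qed.

(** At the infimum of the counterexamples, the closure hypothesis gives [P], and the openness
    hypothesis then pushes the infimum further right, a contradiction. *)
Lemma real_induction (P : R -> Prop) : P 0 ->
  (forall t, 0 < t -> (forall s, 0 <= s < t -> P s) -> P t) ->
  (forall t, 0 <= t -> P t -> \forall h \near 0^'+, P (t + h)) ->
  forall t, 0 <= t -> P t.
Proof.
move=> P0 Pclosed Popen t t0; apply: contrapT => nPt.
pose A := [set s : R | 0 <= s /\ ~ P s].
have Alb : lbound A 0 by move=> s [].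
have Ainf : has_inf A by split; [exists t|exists 0].
have T0 : 0 <= inf A by apply: lb_le_inf => //; exists t.
have below s : 0 <= s < inf A -> P s.
  move=> /andP[s0 sT]; apply: contrapT => nPs.
  by have := ge_inf (ex_intro _ 0 Alb) (conj s0 nPs); rewrite leNgt sT.
have PT : P (inf A).
  by have [<-//|T1] := eqVneq 0 (inf A); apply: Pclosed => //; rewrite lt_neqAle T1.
have [r /= r0 hr] := Popen _ T0 PT.
suff : inf A + r <= inf A by rewrite gerDl leNgt r0.
apply: lb_le_inf; first by exists t.
move=> s [s0 nPs]; rewrite leNgt; apply/negP => sr; apply: nPs.
have [sT|sT] := ltP s (inf A); first by apply: below; rewrite s0.
have [->//|sT'] := eqVneq s (inf A).
have {sT' sT}sT : 0 < s - inf A by rewrite subr_gt0 lt_neqAle eq_sym sT'.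
rewrite -(subrK (inf A) s) addrC; apply: hr => //=.
by rewrite sub0r normrN gtr0_norm// ltrBlDl.
Qed.

(** Bookkeeping for one Euler step of size [h] tested on a vector of squared norm [N]: [q0] and [q1]
    are the form before and after, [q2], [l] and [g] the forms of the generator term, of [L 1] and
    of the second-order term, [ea] and [x] the old and new perturbations. The excess [ea * h] in [x]
    is spent half on [g] and half on the Euler error. *)
Lemma euler_arith (N g l q1 q0 q2 ea h dk dl de x : R) :
  0 <= N -> 0 < h -> 0 < ea -> g <= dk * N -> l <= dl * N -> de <= ea / 2 ->
  h * dk <= ea / 2 -> ea * (1 + (dl + 1) * h) <= x ->
  - (de * h * N) <= q1 - q0 - h * q2 ->
  0 <= q0 + ea * N + h * (q2 + ea * l) + h ^+ 2 * g ->
  0 <= q1 + x * N.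
Proof.
move=> N0 h0 ea0 hg hl hde hdk hx hq hp.
have h1 : h ^+ 2 * g <= h * (ea / 2) * N.
  apply: le_trans (ler_wpM2l (sqr_ge0 h) hg) _.
  have -> : h ^+ 2 * (dk * N) = h * (h * dk) * N by ring.
  by rewrite ler_wpM2r// ler_pM2l.
have h2 : h * (ea * l) <= h * (ea * (dl * N)) by rewrite !ler_pM2l.
have h3 : de * h * N <= ea / 2 * h * N by rewrite !ler_wpM2r// ltW.
have h4 : ea * (1 + (dl + 1) * h) * N <= x * N by rewrite ler_wpM2r.
lra.
Qed.

End RealDerivatives.

(** * Algebra of the Lindblad generator *)

Section LindbladForm.
Context {R : realType} {d n : nat}.
Local Notation C := R[i].
Variables (H : 'M[C]_d) (Cs : 'I_n.+1 -> 'M[C]_d).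
Implicit Types (rho X : 'M[C]_d).

Fact lindblad_is_linear : linear (lindblad H Cs).
Proof.
move=> a X Y; rewrite /lindblad.
rewrite [in RHS]scalerDr addrACA; congr (_ + _).
  rewrite scalerA [a * _]mulrC -scalerA -scalerDr; congr (_ *: _).
  rewrite mulmxDr mulmxDl -scalemxAr -scalemxAl scalerBr.
  by rewrite opprD addrACA.
rewrite scaler_sumr -big_split; apply: eq_bigr => k _ /=.
rewrite scalerBr scalerA [a * _]mulrC -scalerA addrACA -opprD -scalerDr.
rewrite !(mulmxDr, mulmxDl) -!(scalemxAr, scalemxAl).
congr (_ - _ *: _); by rewrite addrACA -scalerDr.
Qed.

HB.instance Definition _ := GRing.isLinear.Build C 'M[C]_d 'M[C]_d _
  (lindblad H Cs) lindblad_is_linear.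

Lemma lindbladZ a X : lindblad H Cs (a *: X) = a *: lindblad H Cs X.
Proof. exact: linearZ. Qed.

(** The effective non-Hermitian Hamiltonian times [- 'i]; it collects the terms of the generator
    that multiply on one side only. *)
Definition lindblad_drift : 'M[C]_d :=
  - 'i *: H - 2^-1 *: \sum_k ((Cs k)^t* *m Cs k).

Hypothesis hH : H \is hermsymmx.

Lemma lindbladE X : lindblad H Cs X =
  lindblad_drift *m X + X *m lindblad_drift^t* +
  \sum_k Cs k *m X *m (Cs k)^t*.
Proof.
have HH : H^t* = H.
  by have /is_hermitianmxP := hH; rewrite expr0 scale1r => <-.
have -> : lindblad_drift^t* = 'i *: H - 2^-1 *: \sum_k ((Cs k)^t* *m Cs k).
  rewrite /lindblad_drift trmxCB !trmxCZ HH trmxC_sum rmorphN/= conjCi opprK.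
  rewrite fmorphV/= conjC_nat; congr (_ - _ *: _); apply: eq_bigr => k _.
  by rewrite trmxCM trmxCK.
rewrite /lindblad /lindblad_drift big_split/= sumrN -scaler_sumr big_split/=.
rewrite mulmxBl mulmxBr -!scalemxAl -!scalemxAr mulmx_suml mulmx_sumr.
rewrite scalerBr scalerDr !scaleNr opprK.
move: ('i *: _) ('i *: _) (_ *: \sum_k _) (_ *: \sum_k _) => p q u w.
move: (\sum_k _) => s.
by apply/matrixP => i j; rewrite !mxE; ring.
Qed.

Lemma lindblad_tr X : \tr (lindblad H Cs X) = 0.
Proof.
rewrite /lindblad mxtraceD mxtraceZ raddfB/= mxtrace_mulC subrr mulr0 add0r.
rewrite raddf_sum big1// => k _; rewrite raddfB/= mxtraceZ mxtraceD.
rewrite (mxtrace_mulC X) [X in X - _]mxtrace_mulC mulmxA.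
by move: (\tr _) => z; field.
Qed.

Lemma lindblad_adj X : (lindblad H Cs X)^t* = lindblad H Cs (X^t*).
Proof.
have Dk k : (Cs k *m X *m (Cs k)^t*)^t* = Cs k *m X^t* *m (Cs k)^t*.
  by rewrite trmxCM [in LHS]trmxCM trmxCK mulmxA.
rewrite !lindbladE; move: lindblad_drift => G.
rewrite trmxCD trmxC_sum (eq_bigr _ (fun k _ => Dk k)); congr +%R.
by rewrite trmxCD [(G *m X)^t*]trmxCM [(X *m _)^t*]trmxCM trmxCK addrC.
Qed.

End LindbladForm.

(** * The flow preserves positivity and trace *)

Section Positivity.
Context {R : realType} {d n : nat}.
Local Notation C := R[i].
Local Notation re := (@complex.Re R).
Variables (H : 'M[C]_d) (Cs : 'I_n.+1 -> 'M[C]_d).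
Hypothesis hH : H \is hermsymmx.
Implicit Types (rho X A : 'M[C]_d) (v : 'cV[C]_d) (t : R).
Local Notation L := (lindblad H Cs).
Local Notation E := (exp_flow (lindblad H Cs)).

Lemma trform_outer a v X : trform (a *: (v *m v^t*)) X = a * sesq X v v.
Proof.
rewrite sesq_trace /trform -scalemxAl mxtraceZ; congr (_ * _).
by rewrite mxtrace_mulC.
Qed.

Lemma is_derive_flow (phi : {scalar 'M[C]_d}) rho t :
  is_derive t (1 : R) (fun t => re (phi (E t rho))) (re (phi (L (E t rho)))).
Proof. exact: is_derive_exp_flow. Qed.

Definition rqf A v : R := re (sesq A v v).

Lemma rqfD A B v : rqf (A + B) v = rqf A v + rqf B v.
Proof. by rewrite /rqf sesqD reD. Qed.

Lemma rqfN A v : rqf (- A) v = - rqf A v.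
Proof. by rewrite /rqf sesqN reN. Qed.

Lemma rqfZ (a : R) A v : rqf (a%:C *: A) v = a * rqf A v.
Proof. by rewrite /rqf sesqZ reMr. Qed.

Lemma rqf_sqnorm_ge0 v : 0 <= rqf 1%:M v.
Proof. by have := sqnorm_ge0 v; rewrite lecE => /andP[]. Qed.

Lemma psd_rqf_ge0 A v : psdmx A -> 0 <= rqf A v.
Proof. by move=> /(_ v); rewrite lecE => /andP[]. Qed.

Lemma rqf_bound A (a : R) v : (forall i j, `|A i j| <= a%:C) ->
  `|rqf A v| <= d%:R * a * rqf 1%:M v.
Proof.
move=> hA; rewrite -lecR (le_trans (normc_ge_Re _))//.
rewrite (le_trans (sesq_bound v hA))// !rmorphM/= rmorph_nat.
by rewrite /rqf RRe_real// ger0_real// -/(sqnorm v) sqnorm_ge0.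
Qed.

Lemma real_entries_bound A : exists2 a : R, 0 < a & forall i j, `|A i j| <= a%:C.
Proof.
have [a a0 ha] := entries_bound A.
exists (re a); first by move: a0; rewrite ltcE => /andP[].
by move=> i j; rewrite RRe_real// gtr0_real.
Qed.

Lemma is_derive_flow_rqf rho v t :
  is_derive t (1 : R) (fun t => rqf (E t rho) v) (rqf (L (E t rho)) v).
Proof.
have := is_derive_flow (trform (1 *: (v *m v^t*))) rho t.
rewrite /= trform_outer mul1r; congr is_derive; apply/funext => s.
by rewrite trform_outer mul1r.
Qed.

(** The generator commutes with the adjoint, so every term of the exponential series is
    Hermitian. *)
Lemma flow_im0 rho v t : rho^t* = rho -> complex.Im (sesq (E t rho) v v) = 0.
Proof.
move=> rhoh.
rewrite -re_iM -trform_outer; apply: exp_flow_eq0 => k.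
rewrite /= trform_outer re_iM; set X := iter _ _ _.
have Xh : X^t* = X.
  rewrite /X; elim: k {X} => [|k IH]; first exact: rhoh.
  by rewrite iterS (lindblad_adj Cs hH) IH.
have : sesq X v v \is Num.real by apply/CrealP; rewrite -sesq_adj Xh.
by move=> /RIm_real/complexI.
Qed.

Lemma flow_approx rho t (e : R) : 0 < e -> \forall h \near 0^'+,
  forall ij, `|(E (t + h) rho - E t rho - h%:C *: L (E t rho)) ij.1 ij.2| <= (e * h)%:C.
Proof.
move=> e0; apply: filter_forall => -[i j] /=.
have e2 : 0 < e / 2 by rewrite divr_gt0.
have h1 := is_derive_approx (is_derive_flow (trform (1 *: delta_mx j i)) rho t) e2.
have h2 := is_derive_approx (is_derive_flow (trform (- 'i *: delta_mx j i)) rho t) e2.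
move: h1 h2; move: (L (E t rho)) => D h1 h2.
apply: filterS2 h1 h2 => h /=; rewrite !trform_delta !mul1r !re_iM => h1 h2.
rewrite (le_trans (normc_le_reim _))// lecR (splitr e) mulrDl.
by rewrite !mxE lerD// ?(reD, reN, reMr, imB, imMr)//.
Qed.

Local Notation G := (lindblad_drift H Cs).

(* The left-hand side is [(1 + h G) X (1 + h G)^*] plus [h] times the jump
   terms: a second-order correction makes the Euler step positive. *)
Lemma psd_euler_step (h : R) X : 0 <= h -> psdmx X ->
  psdmx (X + h%:C *: L X + (h ^+ 2)%:C *: (G *m X *m G^t*)).
Proof.
move=> h0 Xp.
have -> : X + h%:C *: L X + (h ^+ 2)%:C *: (G *m X *m G^t*) =
    (1%:M + h%:C *: G) *m X *m (1%:M + h%:C *: G)^t* +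
    h%:C *: \sum_k Cs k *m X *m (Cs k)^t*.
  rewrite (lindbladE Cs hH).
  move: (lindblad_drift H Cs) (\sum_(k < n.+1) Cs k *m X *m (Cs k)^t*) => K S.
  have hR : Num.conj (h%:C : C) = h%:C.
    by apply/CrealP; rewrite complex_real.
  rewrite trmxCD trmxC1 trmxCZ hR !mulmxDl !mulmxDr !mul1mx !mulmx1.
  rewrite -!(scalemxAl, scalemxAr) scalerA -rmorphM/= -expr2 !scalerDr.
  move: (h%:C) (_ ^+ 2)%:C (K *m X) (X *m _) (K *m X *m _) => a b M2 M3 M1.
  by apply/matrixP => i j; rewrite !mxE; ring.
apply: psdD; first exact: psd_conjmx.
by apply: psdZ; [rewrite ler0c|apply: psd_sum => k; exact: psd_conjmx].
Qed.

(* With [c] large, [eps e^{ct} 1] is a strict supersolution, whose excess of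
   order [h] absorbs the [o(h)] error of an Euler step. *)
Lemma exp_flow_perturbed_ge0 rho : psdmx rho -> exists c : R,
  forall eps, 0 < eps -> forall t, 0 <= t ->
  forall v, 0 <= rqf (E t rho) v + eps * expR (c * t) * rqf 1%:M v.
Proof.
move=> rhop; have [l l0 Hl] := real_entries_bound (L 1%:M).
(* [d%:R * l] compensates the form of [L 1]; the extra 1 is the excess that absorbs the errors. *)
exists (d%:R * l + 1) => eps eps0; set c := _ + 1.
apply: real_induction => [v|t t0 Ps v|t t0 Pt].
- have -> : rqf (E 0 rho) v = rqf rho v.
    have := exp_flow0 L (trform (1 *: (v *m v^t*))) rho.
    by rewrite /= !trform_outer !mul1r.
  by rewrite addr_ge0 ?psd_rqf_ge0// !mulr_ge0 ?rqf_sqnorm_ge0// ?expR_ge0 ?ltW.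
(* Closure: a negative value at [t] would by continuity persist just to the left of [t]. *)
- pose g s := rqf (E s rho) v + eps * expR (c * s) * rqf 1%:M v.
  rewrite -[leRHS]/(g t) leNgt; apply/negP => gt0.
  have cg : {for t, continuous g}.
    apply: cvgD.
      have [+ _] := is_derive_flow_rqf rho v t.
      by move/derivable1_diffP/differentiable_continuous.
    apply: cvgMl; apply: cvgMr.
    apply: continuous_comp; first by apply: cvgMr; exact: cvg_id.
    exact: continuous_expR.
  have gneg : \forall s \near t, g s < 0 by exact: (cvgr_lt _ cg).
  have gneg' : \forall s \near t^'-, g s < 0 by exact: (cvg_within _ gneg).
  near t^'- => s.
  have : g s < 0 by near: s.
  rewrite ltNge => /negP; apply; apply: Ps.
  apply/andP; split=> //.
  by near: s; exact: nbhs_left_ge.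
- set a := expR (c * t); have a0 : 0 < a by exact: expR_gt0.
  have ea0 : 0 < eps * a by rewrite mulr_gt0.
  (* The Euler step is applied to the perturbed matrix, which is positive by the induction
     hypothesis. *)
  set Y := E t rho + (eps * a)%:C *: 1%:M.
  have rY v : rqf Y v = rqf (E t rho) v + eps * a * rqf 1%:M v.
    by rewrite rqfD rqfZ.
  have Yp : psdmx Y.
    move=> v; rewrite -/(sesq _ _ _) lecE -/(rqf _ _) rY Pt andbT.
    rewrite sesqD sesqZ imD imMr (flow_im0 _ _ (psd_herm rhop)).
    by rewrite -/(sqnorm v) (ger0_Im (sqnorm_ge0 v)) mulr0 addr0.
  have rLY v : rqf (L Y) v = rqf (L (E t rho)) v + eps * a * rqf (L 1%:M) v.
    by rewrite /Y linearD linearZ rqfD rqfZ.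
  clearbody Y.
  have [k k0 Hk] := real_entries_bound (G *m Y *m G^t*).
  (* [e] limits the Euler error, and below the bound on [h] by [r] the second-order term, to half of
     the excess each. *)
  pose e := eps * a / (2 * (d%:R + 1)).
  have dp : (0 : R) < d%:R + 1 by rewrite ltr_wpDl.
  have e0 : 0 < e by rewrite divr_gt0// mulr_gt0.
  have er := flow_approx rho t e0.
  have kp : 0 < d%:R * k + 1 by rewrite ltr_wpDl// mulr_ge0// ltW.
  pose r := eps * a / (2 * (d%:R * k + 1)).
  have r0 : 0 < r by rewrite divr_gt0// mulr_gt0.
  (* The step [h] is fixed before [v]: all error bounds are entrywise, hence uniform in [v]. *)
  near=> h => v.
  have h0 : 0 < h by near: h; exact: nbhs_right_gt.
  have hk : h * (d%:R * k) <= eps * a / 2.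
    have hr : h <= r by near: h; exact: nbhs_right_le.
    apply: le_trans (_ : r * (d%:R * k + 1) <= _).
      by rewrite ler_pM ?mulr_ge0 ?(ltW h0) ?(ltW k0)// lerDl.
    by rewrite /r invfM !mulrA mulfVK// gt_eqF.
  have Herr : forall ij,
    `|(E (t + h) rho - E t rho - h%:C *: L (E t rho)) ij.1 ij.2| <= (e * h)%:C.
    by near: h.
  have herr : `|rqf (E (t + h) rho - E t rho - h%:C *: L (E t rho)) v|
      <= d%:R * (e * h) * rqf 1%:M v.
    by apply: rqf_bound => i j; exact: (Herr (i, j)).
  have hG := rqf_bound v Hk.
  have hL := rqf_bound v Hl.
  have := psd_rqf_ge0 v (psd_euler_step (ltW h0) Yp).
  rewrite 2!rqfD 2!rqfZ rY rLY.
  move: herr; rewrite 2!rqfD 2!rqfN rqfZ.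
  have N0 := rqf_sqnorm_ge0 v.
  have de : d%:R * e <= eps * a / 2.
    apply: le_trans (_ : (d%:R + 1) * e <= _).
      by rewrite ler_wpM2r ?(ltW e0)// lerDl.
    by rewrite mulrC /e invfM !mulrA mulfVK// gt_eqF.
  have ae : a * (1 + c * h) <= expR (c * (t + h)).
    by rewrite [c * (t + h)]mulrDr expRD ler_pM2l// expR_ge1Dx.
  have {}ae : eps * a * (1 + (d%:R * l + 1) * h) <= eps * expR (c * (t + h)).
    by rewrite -mulrA ler_pM2l.
  move=> herr hpsd.
  apply: (euler_arith N0 h0 ea0 (ler_normlW hG) (ler_normlW hL) de hk ae _ hpsd).
  by move: herr; rewrite ler_norml => /andP[+ _]; rewrite mulrA.
Unshelve. all: by end_near. Qed.

Lemma exp_flow_psd rho t : psdmx rho -> 0 <= t -> psdmx (E t rho).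
Proof.
move=> rhop t0 v; rewrite -/(sesq _ _ _) lecE (flow_im0 _ _ (psd_herm rhop)) eqxx/=.
have [c hc] := exp_flow_perturbed_ge0 rhop.
rewrite -/(rqf _ _); apply/ler_addgt0Pr => e e0.
pose N := rqf 1%:M v.
have N0 : 0 <= N by exact: rqf_sqnorm_ge0.
have a0 : 0 < expR (c * t) by exact: expR_gt0.
(* With this choice the perturbation at time [t] is at most [e]; [N + 1] replaces [N], which may be
   0. *)
pose eps := e / (expR (c * t) * (N + 1)).
have N1 : 0 < N + 1 by rewrite ltr_wpDl.
have eps0 : 0 < eps by rewrite divr_gt0// mulr_gt0.
apply: le_trans (hc _ eps0 _ t0 v) _; rewrite lerD2l -/N.
have -> : eps * expR (c * t) * N = e * (N / (N + 1)).
  by rewrite /eps; field; rewrite !gt_eqF.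
by rewrite ler_piMr ?(ltW e0)// ler_pdivrMr// mul1r lerDl.
Qed.

Lemma re_exp_flow_cst (phi : {scalar 'M[C]_d}) rho t :
  (forall X, re (phi (L X)) = 0) -> re (phi (E t rho)) = re (phi rho).
Proof.
move=> phi0; rewrite -(exp_flow0 L phi rho).
have df s : is_derive s (1 : R) (fun s => re (phi (E s rho))) 0.
  by rewrite -(phi0 (E s rho)); exact: is_derive_flow.
exact: (is_derive_0_is_cst t 0 df).
Qed.

Lemma exp_flow_cst A rho t : (forall X, trform A (L X) = 0) ->
  trform A (E t rho) = trform A rho.
Proof.
move=> A0; apply/eqP; rewrite eq_complex; apply/andP; split; apply/eqP.
  by apply: re_exp_flow_cst => X; rewrite /= A0.
have imE X : complex.Im (trform A X) = re (trform (- 'i *: A) X).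
  by rewrite trformZ re_iM.
by rewrite !imE; apply: re_exp_flow_cst => X; rewrite /= -imE A0.
Qed.

Lemma exp_flow_tr rho t : \tr (E t rho) = \tr rho.
Proof.
have trE X : \tr X = trform 1%:M X by rewrite /trform mul1mx.
by rewrite !trE; apply: exp_flow_cst => X; rewrite -trE lindblad_tr.
Qed.

Lemma exp_flow_state rho t : is_state rho -> 0 <= t -> is_state (E t rho).
Proof.
by move=> [rhop rho1] t0; split; [exact: exp_flow_psd|rewrite exp_flow_tr].
Qed.

End Positivity.

(** * Lyapunov functions imply stability *)

Section Support.
Context {R : realType} {d : nat}.
Local Notation C := R[i].
Variable S : {vspace 'cV[C]_d}.
Implicit Types (rho X A : 'M[C]_d) (v x : 'cV[C]_d).
Local Notation P := (orthoproj S).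

Definition coproj : 'M[C]_d := 1%:M - orthoproj S.
Local Notation Q := coproj.

Lemma orthoproj_herm : P^t* = P. Proof. by have [] := orthoprojP S. Qed.

Lemma orthoproj_idem : P *m P = P. Proof. by have [] := orthoprojP S. Qed.

Lemma coproj_herm : Q^t* = Q.
Proof. by rewrite /coproj trmxCB trmxC1 orthoproj_herm. Qed.

Lemma coproj_idem : Q *m Q = Q.
Proof.
by rewrite /coproj mulmxBl mul1mx mulmxBr mulmx1 orthoproj_idem subrr subr0.
Qed.

Lemma orthoproj_coproj : P *m Q = 0.
Proof. by rewrite /coproj mulmxBr mulmx1 orthoproj_idem subrr. Qed.

Lemma coproj_orthoproj : Q *m P = 0.
Proof. by rewrite /coproj mulmxBl mul1mx orthoproj_idem subrr. Qed.

Lemma proj_psd A : A^t* = A -> A *m A = A -> psdmx A.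
Proof.
by move=> Ah AA x; rewrite -/(sesq _ _ _) sesq_proj// sqnorm_ge0.
Qed.

Lemma coproj_psd : psdmx Q.
Proof. by apply: proj_psd; rewrite ?coproj_herm ?coproj_idem. Qed.

Lemma orthoproj_psd : psdmx P.
Proof. by apply: proj_psd; rewrite ?orthoproj_herm ?orthoproj_idem. Qed.

Lemma supported_stateE rho : is_state rho ->
  is_supported_state S rho <-> \tr (Q *m rho) = 0.
Proof.
move=> rhos; have [_ rho1] := rhos.
rewrite /coproj mulmxBl mul1mx raddfB/= rho1; split=> [[_ ->]|/eqP].
  by rewrite subrr.
by rewrite subr_eq0 eq_sym => /eqP.
Qed.

Lemma psd_tr_eq0 A : psdmx A -> \tr A = 0 -> A = 0.
Proof.
move=> Ap /eqP; rewrite /mxtrace psumr_eq0 => [/allP A0|i _]; last first.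
  exact: psd_entry_ge0.
apply/matrixP => i j; rewrite [RHS]mxE.
have Aj : A j j = 0 by apply/eqP/A0; rewrite mem_index_enum.
have /colP/(_ i) : A *m delta_mx j ord0 = 0 :> 'cV_d.
  by apply: psd_ker; rewrite ?sesq_delta.
by rewrite -colE !mxE.
Qed.

Lemma tr_coproj_conj X : \tr (Q *m X *m Q) = \tr (Q *m X).
Proof. by rewrite mxtrace_mulC mulmxA coproj_idem. Qed.

Lemma coproj_conj_psd X : psdmx X -> psdmx (Q *m X *m Q).
Proof. by move=> Xp; rewrite -{2}coproj_herm; exact: psd_conjmx. Qed.

Lemma tr_coproj_ge0 X : psdmx X -> 0 <= \tr (Q *m X).
Proof.
by move=> Xp; rewrite -tr_coproj_conj; apply/psd_tr_ge0/coproj_conj_psd.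
Qed.

(** A positive matrix whose [Q]-block vanishes has the range of [Q] in its kernel, so its
    off-diagonal blocks vanish as well. *)
Lemma tr_coproj_eq0 X : psdmx X -> \tr (Q *m X) = 0 -> Q *m X = 0.
Proof.
move=> Xp X0.
have QXQ : Q *m X *m Q = 0.
  by apply: psd_tr_eq0; [exact: coproj_conj_psd|rewrite tr_coproj_conj].
have XQ : X *m Q = 0.
  apply: mul0_col => x; apply: psd_ker => //.
  by rewrite -sesq_conj coproj_herm QXQ /sesq mulmx0 mul0mx mxE.
by rewrite -[LHS]trmxCK trmxCM coproj_herm psd_herm// XQ trmx0 map_mx0.
Qed.

(** Here [e] dominates the square root of [tr (Q rho)]. The difference splits as [Q rho + P rho Q],
    and Cauchy-Schwarz bounds each entry of either term by [e]. *)
Lemma offblock_entry_bound rho (e : C) i j : is_state rho -> 0 <= e ->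
  \tr (Q *m rho) <= e ^+ 2 -> `|(rho - P *m rho *m P) i j| <= e + e.
Proof.
move=> rhos e0 he; have [rhop rho1] := rhos.
have diag_le A k : psdmx A -> A k k <= \tr A.
  move=> Ap; rewrite /mxtrace (bigD1 k)//= lerDl sumr_ge0// => l _.
  exact: psd_entry_ge0.
have hQ x k : sesq rho x x <= 1 -> `|sesq rho (Q *m delta_mx k ord0) x| <= e.
  move=> x1; rewrite -(@ler_pXn2r _ 2)// ?nnegrE//.
  apply: le_trans he; rewrite -tr_coproj_conj.
  apply: le_trans (psd_cauchy _ rhop ltr01 x1) _; rewrite mul1r.
  rewrite -sesq_conj coproj_herm sesq_delta.
  exact/diag_le/coproj_conj_psd.
have PrP : psdmx (P *m rho *m P).
  by rewrite -{2}orthoproj_herm; exact: psd_conjmx.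
have -> : rho - P *m rho *m P = Q *m rho + P *m rho *m Q.
  by rewrite /coproj mulmxBl mul1mx mulmxBr mulmx1 addrA subrK.
rewrite mxE (le_trans (ler_normD _ _))// lerD//.
  have -> : (Q *m rho) i j = sesq rho (Q *m delta_mx i ord0) (delta_mx j ord0).
    by rewrite -(sesq_delta (Q *m rho)) /sesq trmxCM coproj_herm !mulmxA.
  by apply: hQ; rewrite sesq_delta state_entry_le1.
have -> : (P *m rho *m Q) i j =
    sesq rho (P *m delta_mx i ord0) (Q *m delta_mx j ord0).
  by rewrite -(sesq_delta (P *m rho *m Q)) /sesq trmxCM orthoproj_herm !mulmxA.
rewrite (psd_conj _ _ rhop) norm_conjC; apply: hQ.
rewrite -sesq_conj orthoproj_herm sesq_delta (le_trans (diag_le _ i PrP))//.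
rewrite mxtrace_mulC mulmxA orthoproj_idem.
have := tr_coproj_ge0 rhop.
by rewrite /coproj mulmxBl mul1mx raddfB/= rho1 subr_ge0.
Qed.

End Support.

(** First [z] is real, as the difference of the real numbers [z + w] and [w]; a positive [z] would
    be cancelled exactly by [s = - (z / w)]. *)
Lemma le0_perturbed (R : realType) (z w : R[i]) : w < 0 ->
  (forall s, 0 < s -> z + s * w < 0) -> z <= 0.
Proof.
move=> w0 hs.
have zr : z \is Num.real.
  rewrite -(addrK w z) rpredB// ?(ltr0_real w0)//.
  by apply: ltr0_real; rewrite -[w]mul1r; exact: hs.
rewrite real_leNgt// ?real0//; apply/negP => z0.
have := hs (- (z / w)); rewrite mulNr mulfVK ?lt_eqF// subrr ltxx.
by rewrite oppr_gt0 pmulr_rlt0// invr_lt0 => /(_ w0).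
Qed.

(** * A strict linear Lyapunov function forces invariance and attractivity *)

Section Sufficiency.
Context {R : realType} {d n : nat}.
Local Notation C := R[i].
Local Notation re := (@complex.Re R).
Variables (H : 'M[C]_d) (Cs : 'I_n.+1 -> 'M[C]_d) (S : {vspace 'cV[C]_d}).
Hypothesis hH : H \is hermsymmx.
Variable V : {scalar 'M[C]_d}.
Implicit Types (rho X A : 'M[C]_d) (x : 'cV[C]_d) (t : R).
Local Notation P := (orthoproj S).
Local Notation Q := (coproj S).
Local Notation L := (lindblad H Cs).
Local Notation E := (exp_flow (lindblad H Cs)).

Hypothesis V_ge0 : forall rho, is_state rho -> 0 <= V rho.
Hypothesis V_eq0 : forall rho, is_state rho ->
  V rho = 0 <-> is_supported_state S rho.
Hypothesis V_lt0 : forall rho, is_state rho -> ~ is_supported_state S rho ->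
  V (L rho) < 0.

Lemma psd_normalize X : psdmx X -> X != 0 ->
  0 < (\tr X)^-1 /\ is_state ((\tr X)^-1 *: X).
Proof.
move=> Xp X0.
have t0 : \tr X != 0 by apply: contra_neq X0; exact: psd_tr_eq0.
have tp : 0 < (\tr X)^-1 by rewrite invr_gt0 lt_neqAle eq_sym t0 psd_tr_ge0.
split=> //; split; first by apply: psdZ => //; exact: ltW.
by rewrite mxtraceZ mulVf.
Qed.

Lemma V_psd_ge0 X : psdmx X -> 0 <= V X.
Proof.
move=> Xp; have [->|X0] := eqVneq X 0; first by rewrite linear0.
have [t0 Xs] := psd_normalize Xp X0.
by have := V_ge0 Xs; rewrite linearZ pmulr_rge0.
Qed.

Lemma V_psd_eq0 X : psdmx X -> V X = 0 <-> \tr (Q *m X) = 0.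
Proof.
move=> Xp; have [->|X0] := eqVneq X 0; first by rewrite linear0 mulmx0 raddf0.
have [t0 Xs] := psd_normalize Xp X0.
have := V_eq0 Xs; rewrite (supported_stateE S Xs) linearZ -scalemxAr mxtraceZ.
have tn : (\tr X)^-1 == 0 = false by rewrite gt_eqF.
move=> [h1 h2]; split=> [VX|QX].
  have /eqP : (\tr X)^-1 * \tr (Q *m X) = 0 by apply: h1; rewrite /= VX mulr0.
  by rewrite mulf_eq0 tn => /eqP.
have /eqP : (\tr X)^-1 * V X = 0 by apply: h2; rewrite QX mulr0.
by rewrite mulf_eq0 tn => /eqP.
Qed.

Lemma V_psd_lt0 X : psdmx X -> \tr (Q *m X) != 0 -> V (L X) < 0.
Proof.
move=> Xp QX.
have X0 : X != 0 by apply: contra_neq QX => ->; rewrite mulmx0 raddf0.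
have [t0 Xs] := psd_normalize Xp X0.
have nsupp : ~ is_supported_state S ((\tr X)^-1 *: X).
  rewrite (supported_stateE S Xs) -scalemxAr mxtraceZ => /eqP.
  by rewrite mulf_eq0 (negbTE QX) orbF gt_eqF.
by have := V_lt0 Xs nsupp; rewrite 2!linearZ pmulr_rlt0.
Qed.

(* The strict inequality passes to the limit along [X + s Q], s -> 0. *)
Lemma V_psd_le0 X : Q != 0 -> psdmx X -> V (L X) <= 0.
Proof.
move=> Q0 Xp; have Qp := coproj_psd S.
have QQ : \tr (Q *m Q) != 0.
  by rewrite coproj_idem; apply: contra_neq Q0; exact: psd_tr_eq0.
have w0 := V_psd_lt0 Qp QQ.
have [QX|QX] := eqVneq (\tr (Q *m X)) 0; last exact/ltW/V_psd_lt0.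
have hs (s : C) : 0 < s -> V (L X) + s * V (L Q) < 0.
  move=> s0; rewrite addrC.
  have <- : V (L (s *: Q + X)) = s * V (L Q) + V (L X).
    by rewrite (lindblad_is_linear H Cs s Q X); exact: linearP.
  apply: V_psd_lt0.
    by apply: psdD Xp; apply: psdZ Qp; exact: ltW.
  by rewrite mulmxDr raddfD/= QX addr0 -scalemxAr mxtraceZ mulf_neq0// gt_eqF.
exact: le0_perturbed w0 hs.
Qed.

Lemma lyapunov_bounds : Q != 0 -> exists c1 c2 : C, [/\ 0 < c1, 0 < c2,
  forall X, psdmx X -> V X <= - (c1 * V (L X)) &
  forall X, psdmx X -> \tr (Q *m X) <= c2 * V X].
Proof.
move=> Q0; have [K KE] := scalar_trform V.
have [W' W'E] := scalar_trform (V \o L : {scalar 'M[C]_d}).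
pose W := - W'.
have WE X : trform W X = - V (L X).
  by rewrite /trform mulNmx raddfN/= -[\tr _]W'E.
have trQ x : \tr (Q *m (x *m x^t*)) = sqnorm (Q *m x).
  by rewrite -sesq_trace sesq_proj ?coproj_herm ?coproj_idem.
have Kp : psdmx K.
  move=> x; rewrite -/(sesq _ _ _) sesq_trace -/(trform K _) -KE.
  exact/V_psd_ge0/psd_outer.
have Wp : psdmx W.
  move=> x; rewrite -/(sesq _ _ _) sesq_trace -/(trform W _) WE oppr_ge0.
  exact/V_psd_le0/psd_outer.
have KQ x : K *m x = 0 -> Q *m x = 0.
  move=> Kx; apply: sqnorm_eq0; rewrite -trQ; apply/(V_psd_eq0 (psd_outer x)).
  by rewrite KE /trform mulmxA Kx mul0mx raddf0.
have QK x : Q *m x = 0 -> K *m x = 0.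
  move=> Qx; apply: psd_ker => //; rewrite sesq_trace -/(trform K _) -KE.
  by apply/(V_psd_eq0 (psd_outer x)); rewrite mulmxA Qx mul0mx raddf0.
have WQ x : W *m x = 0 -> Q *m x = 0.
  move=> Wx; apply: sqnorm_eq0; rewrite -trQ; apply/eqP.
  case: eqVneq => // /(V_psd_lt0 (psd_outer x)).
  by rewrite -oppr_gt0 -WE /trform mulmxA Wx mul0mx raddf0 ltxx.
have Qh := coproj_herm S; have QQ := coproj_idem S.
have [c2 c20 H2] := proj_le_psd Qh QQ Kp KQ.
have [c1 c10 H1] := proj_le_psd Qh QQ Wp WQ.
have [c3 c30 H3] := psd_le_proj Qh QQ Kp QK.
(* The first bound chains [V X <= c3 tr (Q X)] with [tr (Q X) <= - c1 V (L X)]. *)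
exists (c3 * c1), c2; split => //; first exact: mulr_gt0.
  move=> X Xp; rewrite KE; apply: le_trans (psd_scale_sub_trace H3 Xp) _.
  rewrite -mulrA -mulrN ler_pM2l// -mulrN -WE.
  exact: psd_scale_sub_trace H1 Xp.
by move=> X Xp; rewrite KE; exact: psd_scale_sub_trace H2 Xp.
Qed.

Lemma exp_flow_V_nonincr rho t : Q != 0 -> is_state rho -> 0 <= t ->
  re (V (E t rho)) <= re (V rho).
Proof.
move=> Q0 rhos t0; rewrite -(exp_flow0 L V rho).
apply: (is_derive_nonincr t0 (fun s => is_derive_flow H Cs V rho s)) => s s0.
have [Ep _] := exp_flow_state Cs hH rhos s0.
by have := V_psd_le0 Q0 Ep; rewrite lecE => /andP[].
Qed.

Lemma V_flow_real rho t : is_state rho -> 0 <= t ->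
  0 <= re (V (E t rho)) /\ V (E t rho) = (re (V (E t rho)))%:C.
Proof.
move=> rhos t0; have [Ep _] := exp_flow_state Cs hH rhos t0.
have V0 := V_psd_ge0 Ep; split; first by move: V0; rewrite lecE => /andP[].
by rewrite RRe_real// ger0_real.
Qed.

Lemma lyapunov_invariant : Q != 0 -> Defs.invariant L S.
Proof.
move=> Q0 rho [rhos rhoP] t t0.
have Es := exp_flow_state Cs hH rhos t0; apply/(V_eq0 Es).
have [h1 h2] := V_flow_real rhos t0.
have V0 : V rho = 0 by apply/(V_eq0 rhos).
have := exp_flow_V_nonincr Q0 rhos t0; rewrite V0 => h3.
by rewrite h2; apply/eqP; rewrite eq_complex/= eqxx andbT eq_le h1 h3.
Qed.

(** Decay of order [1/t] is enough: from [c V <= - V'] and [V' <= 0], the function [(1 + c t) V] has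
    derivative at most [c t V' <= 0]. *)
Lemma lyapunov_decay rho : Q != 0 -> is_state rho -> exists2 c : R, 0 < c &
  forall t, 0 <= t -> (1 + c * t) * re (V (E t rho)) <= re (V rho).
Proof.
move=> Q0 rhos; have [c1 [c2 [c10 _ h1 _]]] := lyapunov_bounds Q0.
have [c c0 cE] : exists2 c : R, 0 < c & c1 = c%:C.
  exists (re c1); last by rewrite RRe_real// gtr0_real.
  by move: c10; rewrite ltcE => /andP[].
exists c^-1; rewrite ?invr_gt0// => t t0.
pose f s := re (V (E s rho)).
pose g s := (1 + c^-1 * s) * f s.
have g0 : g 0 = re (V rho) by rewrite /g mulr0 addr0 mul1r /f exp_flow0.
rewrite -g0 -[leLHS]/(g t).
have dg s : is_derive s (1 : R) g
    (c^-1 * f s + (1 + c^-1 * s) * re (V (L (E s rho)))).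
  have df : is_derive s (1 : R) f (re (V (L (E s rho)))).
    exact: is_derive_flow.
  have dl : is_derive s (1 : R) (fun s => 1 + c^-1 * s) c^-1.
    have := is_deriveD (is_derive_cst (1 : R) s (1 : R))
      (is_deriveZ c^-1 (is_derive_id s (1 : R))).
    by move=> h; apply: (is_derive_eq h); rewrite add0r; exact: mulr1.
  by apply: (is_derive_eq (is_deriveM dl df)); rewrite addrC [_ *: c^-1]mulrC.
apply: (is_derive_nonincr t0 dg) => s s0.
have [Ep _] := exp_flow_state Cs hH rhos s0.
have [f0 _] := V_flow_real rhos s0.
have := h1 _ Ep; rewrite cE -mulrN lecE => /andP[_].
rewrite reMr reN -/(f s) => hf.
have w0 : re (V (L (E s rho))) <= 0.
  by have := V_psd_le0 Q0 Ep; rewrite lecE => /andP[].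
have hc : c^-1 * f s <= - re (V (L (E s rho))).
  by rewrite mulrC ler_pdivrMr// mulrC.
have : 0 <= c^-1 * s by rewrite mulr_ge0// invr_ge0 ltW.
nra.
Qed.

Lemma lyapunov_attractive : Q != 0 -> attractive L S.
Proof.
move=> Q0 rho rhos; have [c c0 hc] := lyapunov_decay Q0 rhos.
have [_ [c2 [_ c20 _ h2]]] := lyapunov_bounds Q0.
have [b b0 bE] : exists2 b : R, 0 < b & c2 = b%:C.
  exists (re c2); last by rewrite RRe_real// gtr0_real.
  by move: c20; rewrite ltcE => /andP[].
apply/cvgrPdist_lt => e0 e0p.
have [e ep ->] : exists2 e : R, 0 < e & e0 = e%:C.
  exists (re e0); last by rewrite RRe_real// gtr0_real.
  by move: e0p; rewrite ltcE => /andP[].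
(* Then [V <= dl] gives [tr (Q _) <= (e / 3)^2], and each entry off the [S]-block is at most
   [2 e / 3 < e]. *)
pose dl := (e / 3) ^+ 2 / b.
have dl0 : 0 < dl by rewrite divr_gt0// exprn_gt0// divr_gt0.
near=> t.
have t0 : 0 <= t.
  by near: t; apply: nbhs_pinfty_ge; exact: num_real.
have tbig : re (V rho) / (dl * c) <= t.
  by near: t; apply: nbhs_pinfty_ge; exact: num_real.
have Es := exp_flow_state Cs hH rhos t0; have [Ep _] := Es.
have [f0 fE] := V_flow_real rhos t0.
have fle : re (V (E t rho)) <= dl.
  have ct : 0 < 1 + c * t by rewrite ltr_pwDl// mulr_ge0// ltW.
  rewrite -(ler_pM2l ct) (le_trans (hc _ t0))//.
  have dc0 : 0 < dl * c by exact: mulr_gt0.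
  move: tbig; rewrite ler_pdivrMr// => tbig.
  apply: le_trans tbig _; rewrite mulrDl mul1r [dl * c]mulrC mulrA [t * c]mulrC.
  by rewrite lerDr ltW.
have trQ : \tr (Q *m E t rho) <= (e / 3)%:C ^+ 2.
  apply: le_trans (h2 _ Ep) _; rewrite bE fE -rmorphXn -rmorphM lecR.
  by rewrite mulrC -ler_pdivlMr.
rewrite sub0r normrN normr_id.
apply: ltr_mx_norm => [|i j]; first by rewrite ltcR.
have e30 : 0 <= (e / 3)%:C :> C by rewrite ler0c divr_ge0// ltW.
apply: le_lt_trans (offblock_entry_bound i j Es e30 trQ) _.
by rewrite -rmorphD ltcR; lra.
Unshelve. all: by end_near. Qed.

Lemma lyapunov_gas : gas L S.
Proof.
(* If [Q = 0] then [S] is the whole space and both properties are immediate; otherwise [Q] itself is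
   available as a perturbation direction. *)
have [Q0|Q0] := eqVneq Q 0; last first.
  by split; [exact: lyapunov_invariant|exact: lyapunov_attractive].
split.
  move=> rho [rhos _] t t0; have Es := exp_flow_state Cs hH rhos t0.
  by apply/(supported_stateE S Es); rewrite Q0 mul0mx raddf0.
have P1 : P = 1%:M by apply/esym/eqP; rewrite -subr_eq0 -/(coproj S) Q0.
move=> rho _; rewrite P1; apply: cvg_near_cst; apply: nearW => t.
by rewrite mul1mx mulmx1 subrr normr0.
Qed.

End Sufficiency.

(** * Stability yields a Lyapunov function *)

Section Necessity.
Context {R : realType} {d n : nat}.
Local Notation C := R[i].
Local Notation re := (@complex.Re R).
Variables (H : 'M[C]_d) (Cs : 'I_n.+1 -> 'M[C]_d) (S : {vspace 'cV[C]_d}).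
Hypothesis hH : H \is hermsymmx.
Implicit Types (rho X A : 'M[C]_d) (x : 'cV[C]_d) (t : R).
Local Notation P := (orthoproj S).
Local Notation Q := (coproj S).
Local Notation L := (lindblad H Cs).
Local Notation E := (exp_flow (lindblad H Cs)).
Local Notation G := (lindblad_drift H Cs).

Lemma is_derive_trform_flow0 A rho : is_derive (0 : R) (1 : R)
  (fun t => re (trform A (E t rho))) (re (trform A (L rho))).
Proof.
rewrite -(exp_flow0 L (trform A \o L : {scalar 'M[C]_d}) rho).
exact: is_derive_flow.
Qed.

(** A function vanishing for [t >= 0] has derivative 0 at 0. The one-sided criterion is applied to
    the multiples of [A] by 1, -1, [- 'i] and ['i], giving both signs of both parts. *)
Lemma flow_eq0_generator A rho : (forall t, 0 <= t -> trform A (E t rho) = 0) ->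
  trform A (L rho) = 0.
Proof.
move=> A0.
have re0 a : 0 <= re (trform (a *: A) (L rho)).
  apply: (is_derive_right_ge0 (is_derive_trform_flow0 (a *: A) rho)) => s s0.
  by rewrite !trformZ !A0.
have := re0 1; have := re0 (- 1); have := re0 (- 'i); have := re0 (- (- 'i)).
rewrite !trformZ mul1r mulN1r mulNr reN !re_iM reN !oppr_ge0.
case: (trform _ _) => x y /= y1 y2 x1 x2.
by apply/eqP; rewrite eq_complex/= !eq_le x1 x2 y1 y2.
Qed.

(** * Block structure of the generator forced by invariance *)

Section Invariant.
Hypothesis inv : Defs.invariant L S.

(** The normalized [P] is a supported state, so [Q E t] vanishes on it for all [t >= 0];
    differentiate at 0. The case [P = 0], which cannot be normalized, is trivial. *)
Lemma coproj_lindblad_orthoproj : Q *m L P = 0.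
Proof.
have LP0 : P = 0 -> Q *m L P = 0.
  by move=> ->; rewrite -(scale0r 0) lindbladZ !scale0r mulmx0.
have [/LP0//|P0] := eqVneq P 0.
have [t0 Ps] := psd_normalize (orthoproj_psd S) P0.
set rho := _ *: P in Ps.
have rhoP : is_supported_state S rho.
  apply/(supported_stateE S Ps).
  by rewrite /rho -scalemxAr coproj_orthoproj scaler0 raddf0.
have QE t : 0 <= t -> Q *m E t rho = 0.
  move=> t_ge0; have Et := inv rhoP t_ge0; have [Es _] := Et.
  have [Ep _] := Es; apply: (tr_coproj_eq0 Ep).
  exact/(supported_stateE S Es).
have QL : Q *m L rho = 0.
  apply/matrixP => i j; rewrite -[LHS]mul1r -trform_delta [RHS]mxE.
  rewrite /trform mulmxA -/(trform _ _); apply: flow_eq0_generator => t t_ge0.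
  by rewrite /trform -mulmxA QE// mulmx0 raddf0.
move: QL; rewrite /rho lindbladZ -scalemxAr => /eqP.
by rewrite scaler_eq0 gt_eqF// => /eqP.
Qed.

Lemma mulmx_trmxC_eq0 A : A *m A^t* = 0 -> A = 0.
Proof.
move=> AA; have : A^t* = 0.
  rewrite -[LHS]mul1mx; apply: mul0_col => x; rewrite mul1mx.
  by apply: sqnorm_eq0; rewrite sqnorm_mul trmxCK AA /sesq mulmx0 mul0mx mxE.
by move=> /(congr1 (fun B => B^t*)); rewrite trmxCK trmx0 map_mx0.
Qed.

Lemma psd_sum_eq0 (I : finType) (A : I -> 'M[C]_d) :
  (forall i, psdmx (A i)) -> \sum_i A i = 0 -> forall i, A i = 0.
Proof.
move=> Ap A0 i; apply: sesq_polar => x.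
have /eqP : \sum_i sesq (A i) x x = 0.
  by rewrite -sesq_sum A0 /sesq mulmx0 mul0mx mxE.
rewrite psumr_eq0 => [/allP h|j _]; last exact: Ap.
by apply/eqP/h; rewrite mem_index_enum.
Qed.

(** In [Q L(P) Q = 0] the drift terms disappear, leaving a sum of the positive matrices [A A^*] with
    [A = Q C_k P]; each of them is therefore 0. *)
Lemma coproj_jump_orthoproj k : Q *m Cs k *m P = 0.
Proof.
have := coproj_lindblad_orthoproj; rewrite (lindbladE Cs hH).
move=> /(congr1 (fun X => X *m Q)); rewrite mul0mx.
rewrite 2!(mulmxDr Q) 2!(mulmxDl _ _ Q).
have -> : Q *m (G *m P) *m Q = 0.
  by rewrite -!mulmxA orthoproj_coproj !mulmx0.
rewrite (mulmxA Q P) coproj_orthoproj !mul0mx !add0r.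
rewrite mulmx_sumr mulmx_suml => /psd_sum_eq0 h.
have e j : Q *m (Cs j *m P *m (Cs j)^t*) *m Q =
    (Q *m Cs j *m P) *m (Q *m Cs j *m P)^t*.
  rewrite 2!trmxCM coproj_herm orthoproj_herm !mulmxA.
  by rewrite -(mulmxA (Q *m Cs j) P P) orthoproj_idem.
apply: mulmx_trmxC_eq0; rewrite -e; apply: h => j.
by rewrite e -[X in X *m _^t*]mulmx1; apply: psd_conjmx; exact: psd1.
Qed.

Lemma coproj_drift_orthoproj : Q *m G *m P = 0.
Proof.
have := coproj_lindblad_orthoproj; rewrite (lindbladE Cs hH).
rewrite 2!(mulmxDr Q) (mulmxA Q P) coproj_orthoproj mul0mx addr0 mulmx_sumr.
rewrite big1 ?addr0 ?mulmxA// => k _.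
by rewrite !mulmxA coproj_jump_orthoproj mul0mx.
Qed.

Lemma coproj_absorb A : Q *m A *m P = 0 -> Q *m A *m Q = Q *m A.
Proof. by move=> h; rewrite /coproj mulmxBr mulmx1 -/(coproj S) h subr0. Qed.

(** By the two vanishing blocks, [Q C_k = Q C_k Q] and [Q G = Q G Q], so a [Q] can be inserted on
    each side of [X] in every term. *)
Lemma coproj_lindblad_block X : Q *m L X *m Q = Q *m L (Q *m X *m Q) *m Q.
Proof.
have absorb A : Q *m A *m P = 0 -> A^t* *m Q = Q *m A^t* *m Q.
  move=> /coproj_absorb /(congr1 (fun B => B^t*)).
  by rewrite !trmxCM coproj_herm mulmxA.
have GQ := coproj_absorb coproj_drift_orthoproj.
have GQ' := absorb _ coproj_drift_orthoproj.
have CQ k := coproj_absorb (coproj_jump_orthoproj k).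
have CQ' k := absorb _ (coproj_jump_orthoproj k).
have block A B : Q *m A *m Q = Q *m A -> B *m Q = Q *m B *m Q ->
    Q *m (A *m X *m B) *m Q = Q *m (A *m (Q *m X *m Q) *m B) *m Q.
  by move=> AQ BQ; rewrite !mulmxA AQ -!mulmxA [in LHS]BQ !mulmxA.
have b1 : Q *m (G *m X) *m Q = Q *m (G *m (Q *m X *m Q)) *m Q.
  have := block G 1%:M GQ; rewrite !mulmx1 mul1mx coproj_idem.
  by apply.
have b2 : Q *m (X *m G^t*) *m Q = Q *m (Q *m X *m Q *m G^t*) *m Q.
  have := block 1%:M (G^t*); rewrite !mul1mx mulmx1 coproj_idem.
  by move=> /(_ erefl GQ').
have b3 : Q *m (\sum_k Cs k *m X *m (Cs k)^t*) *m Q =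
    Q *m (\sum_k Cs k *m (Q *m X *m Q) *m (Cs k)^t*) *m Q.
  rewrite 2!mulmx_sumr 2!mulmx_suml; apply: eq_bigr => k _.
  by apply: block; [exact: CQ|exact: CQ'].
rewrite (lindbladE Cs hH X) (lindbladE Cs hH (Q *m X *m Q)).
by rewrite 4!(mulmxDr Q) 4!(mulmxDl _ _ Q) b1 b2 b3.
Qed.

End Invariant.

End Necessity.

(** * Solving linear equations through the trace pairing *)

Section DualSolvability.
Context {R : realType} {d : nat}.
Local Notation C := R[i].
Implicit Types (T : {linear 'M[C]_d -> 'M[C]_d}) (A B X : 'M[C]_d).

Lemma trform_delta_mx A i j : trform A (delta_mx i j) = A j i.
Proof.
rewrite /trform mxtrace_mulC -[delta_mx i j]scale1r -/(trform _ _).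
by rewrite trform_delta mul1r.
Qed.

(** The trace pairing is a dot product of vectorized matrices, which reduces questions about forms
    to the ordinary matrix [lin_mx T]. *)
Lemma trform_mxvec A X : trform A X = (mxvec X *m (mxvec A^T)^T) ord0 ord0.
Proof.
rewrite [X in trform _ X](matrix_sum_delta X) linear_sum.
rewrite [X in mxvec X](matrix_sum_delta X) linear_sum mulmx_suml summxE.
apply: eq_bigr => i _.
rewrite !linear_sum mulmx_suml summxE; apply: eq_bigr => j _.
rewrite !linearZ/= -scalemxAl [RHS]mxE; congr (_ * _).
rewrite trform_delta_mx; have -> : delta_mx i j = (delta_mx ord0 i : 'rV[C]_d)^T *m delta_mx ord0 j :> 'M[C]_d.
  by rewrite trmx_delta mul_delta_mx.
by rewrite mxvec_dotmul -rowE trmx_delta -colE !mxE.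
Qed.

Lemma trform_vec_mx (c : 'cV[C]_(d * d)) X :
  trform (vec_mx c^T)^T X = (mxvec X *m c) ord0 ord0.
Proof. by rewrite trform_mxvec trmxK vec_mxK trmxK. Qed.

(* Fredholm alternative: injectivity of the adjoint gives solvability. *)
Lemma trform_adjoint_solve T :
  (forall A, (forall X, trform A (T X) = 0) -> A = 0) ->
  forall B, exists A, forall X, trform A (T X) = trform B X.
Proof.
move=> Tinj B.
have Tu : lin_mx T \in unitmx.
  (* Through the pairing, a vector in the kernel of [lin_mx T] is a form that vanishes on the range
     of [T]. *)
  rewrite -unitmx_tr -row_free_unit -kermx_eq0; apply/eqP/row_matrixP => i.
  rewrite row0; set u := row i _.
  have uT : lin_mx T *m u^T = 0.
    by rewrite -[LHS]trmxK trmx_mul trmxK /u -row_mul mulmx_ker row0 trmx0.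
  have /(congr1 trmx) : (vec_mx u^T^T)^T = 0.
    by apply: Tinj => X; rewrite trform_vec_mx -mul_vec_lin -mulmxA uT mulmx0 mxE.
  by rewrite !trmxK trmx0 => /(congr1 mxvec); rewrite vec_mxK linear0.
exists (vec_mx (invmx (lin_mx T) *m (mxvec B^T)^T)^T)^T => X.
by rewrite trform_vec_mx -mul_vec_lin -mulmxA mulKVmx// trform_mxvec.
Qed.

End DualSolvability.

(** * Construction of the Lyapunov form *)

Section Lyapunov.
Context {R : realType} {d n : nat}.
Local Notation C := R[i].
Local Notation re := (@complex.Re R).
Variables (H : 'M[C]_d) (Cs : 'I_n.+1 -> 'M[C]_d) (S : {vspace 'cV[C]_d}).
Hypothesis hH : H \is hermsymmx.
Implicit Types (rho X A : 'M[C]_d) (x : 'cV[C]_d) (t : R).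
Local Notation P := (orthoproj S).
Local Notation Q := (coproj S).
Local Notation L := (lindblad H Cs).
Local Notation E := (exp_flow (lindblad H Cs)).

Hypothesis inv : Defs.invariant L S.
Hypothesis att : attractive L S.

(* This is the compression of [L] to the [Q]-block, completed by the identity
   on its complement so as to be invertible on all matrices. *)
Definition block_generator X : 'M[C]_d :=
  Q *m L (Q *m X *m Q) *m Q + (X - Q *m X *m Q).

Fact block_generator_is_linear : linear block_generator.
Proof.
move=> a X Y; rewrite /block_generator.
have cL Z W : Q *m (a *: Z + W) *m Q = a *: (Q *m Z *m Q) + Q *m W *m Q.
  by rewrite (mulmxDr Q) (mulmxDl _ _ Q) -scalemxAr -scalemxAl.
rewrite cL lindblad_is_linear cL.
have regroup (x y r s p q : 'M[C]_d) : a *: p + q + (a *: x + y - (a *: r + s)) =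
    a *: (p + (x - r)) + (q + (y - s)).
  by apply/matrixP => i j; rewrite !mxE; ring.
exact: regroup.
Qed.

HB.instance Definition _ := GRing.isLinear.Build C 'M[C]_d 'M[C]_d _
  block_generator block_generator_is_linear.

(** Equivalently [A = Q A Q]: the form sees only the [Q]-block. *)
Definition blocked A := forall X, trform A X = trform A (Q *m X *m Q).

Lemma coproj_cut X : Q *m (Q *m X *m Q) *m Q = Q *m X *m Q.
Proof. by rewrite !mulmxA coproj_idem -mulmxA coproj_idem. Qed.

(** A matrix with zero [Q]-block is fixed by [block_generator], and the right-hand side vanishes on
    it, so the form of [A] does too. It is used with [a = 0] for injectivity and [a = -1] for the
    Lyapunov form. *)
Lemma block_generator_blocked A (a : C) :
  (forall X, trform A (block_generator X) = a * \tr (Q *m X)) ->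
  blocked A /\ forall X, trform A (L X) = a * \tr (Q *m X).
Proof.
move=> AT.
have A_off X : Q *m X *m Q = 0 -> trform A X = 0.
  move=> X0; have := AT X; rewrite /block_generator X0.
  rewrite -(scale0r (0 : 'M[C]_d)) lindbladZ !scale0r mulmx0 mul0mx add0r subr0.
  by move=> ->; rewrite -tr_coproj_conj X0 raddf0 mulr0.
have Ab : blocked A.
  move=> X; apply/eqP; rewrite -subr_eq0 -trformB; apply/eqP/A_off.
  by rewrite (mulmxBr Q) (mulmxBl _ _ Q) coproj_cut subrr.
split=> // X; rewrite Ab (coproj_lindblad_block hH inv).
have := AT (Q *m X *m Q); rewrite /block_generator coproj_cut subrr addr0 => ->.
by rewrite mulmxA mulmxA coproj_idem tr_coproj_conj.
Qed.

(** A blocked form ignores [P X P], so along the flow it takes the same value on the difference that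
    attractivity sends to 0. *)
Lemma blocked_flow_to0 A rho : blocked A -> is_state rho ->
  forall e : R, 0 < e -> exists2 t, 0 <= t & `|trform A (E t rho)| <= e%:C.
Proof.
move=> Ab rhos e e0.
have [M M0 HM] := scalar_bound (trform A).
pose K : C := 1 + M * (d * d)%:R.
have K0 : 0 < K by rewrite ltr_pwDl// mulr_ge0.
have eK : 0 < e%:C / K by rewrite divr_gt0// ltcR.
have /cvgrPdist_lt/(_ _ eK) h := att rhos.
near +oo_R => t.
exists t; first by near: t; exact: nbhs_pinfty_ge.
have ht : `|0 - `|E t rho - P *m E t rho *m P| | < e%:C / K by near: t.
have {ht} : `|E t rho - P *m E t rho *m P| < e%:C / K.
  by move: ht; rewrite sub0r normrN normr_id.
have -> : trform A (E t rho) = trform A (E t rho - P *m E t rho *m P).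
  rewrite trformB [trform A (P *m _ *m P)]Ab !mulmxA coproj_orthoproj !mul0mx.
  by rewrite /trform mulmx0 raddf0 subr0.
move: (_ - _) => Y hY.
apply: le_trans (HM _) _; apply: le_trans (ler_wpM2l M0 (norm1_le_norm _)) _.
rewrite mulrA; apply: (@le_trans _ _ (K * `|Y|)).
  by rewrite ler_wpM2r// lerDr.
by rewrite mulrC -ler_pdivlMr// ltW.
Unshelve. all: by end_near. Qed.

(** Such a form is constant along the flow and takes arbitrarily small values there, so it is 0 on
    every state; rank-one states determine [A]. *)
Lemma block_adjoint_inj A : (forall X, trform A (block_generator X) = 0) -> A = 0.
Proof.
move=> AT.
have [Ab AL] : blocked A /\ forall X, trform A (L X) = 0 * \tr (Q *m X).
  by apply: block_generator_blocked => X; rewrite mul0r.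
have Arho rho : is_state rho -> trform A rho = 0.
  move=> rhos; apply/eqP; rewrite -normr_eq0 eq_le normr_ge0 andbT.
  rewrite normc_def lecR; apply/ler_addgt0Pr => e e0; rewrite add0r.
  have [t t0] := blocked_flow_to0 Ab rhos e0.
  rewrite exp_flow_cst; first by rewrite normc_def lecR.
  by move=> X; rewrite AL mul0r.
apply: sesq_polar => x; rewrite sesq_trace.
have [->|x0] := eqVneq x 0; first by rewrite mul0mx mulmx0 raddf0.
have := Arho _ (outer_state x0); rewrite /trform -scalemxAr mxtraceZ => /eqP.
rewrite mulf_eq0 invr_eq0 => /orP[/eqP/sqnorm_eq0 x00|/eqP//].
by rewrite x00 eqxx in x0.
Qed.

(** The real part does not increase along the flow and comes arbitrarily close to 0, so it cannot
    start below 0. *)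
Lemma re_trform_ge0 A rho : blocked A -> is_state rho ->
  (forall X, psdmx X -> re (trform A (L X)) <= 0) -> 0 <= re (trform A rho).
Proof.
move=> Ab rhos AL; apply/ler_addgt0Pr => e e0.
have [t t0 ht] := blocked_flow_to0 Ab rhos e0.
have : re (trform A (E t rho)) <= re (trform A rho).
  rewrite -(exp_flow0 L (trform A) rho).
  apply: (is_derive_nonincr t0 (fun s => is_derive_flow H Cs (trform A) rho s)).
  by move=> s s0; apply: AL; have [] := exp_flow_state Cs hH rhos s0.
have : `|re (trform A (E t rho))| <= e.
  by rewrite -lecR; apply: le_trans (normc_ge_Re _) ht.
rewrite ler_norml => /andP[h1 _] h2.
lra.
Qed.

Lemma gas_lyapunov : exists V : {scalar 'M[C]_d},
  (forall rho, is_state rho ->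
     0 <= V rho /\ (V rho = 0 <-> is_supported_state S rho)) /\
  (forall rho, is_state rho -> ~ is_supported_state S rho -> V (L rho) < 0).
Proof.
(* The form is defined by prescribing its derivative along the flow to be [- tr (Q _)]. *)
have [K KT] := trform_adjoint_solve block_adjoint_inj (- Q).
have [Kb KL] : blocked K /\ forall X, trform K (L X) = -1 * \tr (Q *m X).
  apply: block_generator_blocked => X; rewrite KT.
  by rewrite /trform mulNmx raddfN mulN1r.
have K0 rho : is_state rho -> 0 <= trform K rho.
  move=> rhos.
  have bZ a : blocked (a *: K) by move=> X; rewrite !trformZ Kb.
  have LZ a X : trform (a *: K) (L X) = - (a * \tr (Q *m X)).
    by rewrite trformZ KL mulN1r mulrN.
  have trim X : psdmx X -> complex.Im (\tr (Q *m X)) = 0.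
    by move=> Xp; apply/ger0_Im/tr_coproj_ge0.
  have h1 : 0 <= re (trform K rho).
    apply: re_trform_ge0 => // X Xp; rewrite KL mulN1r reN oppr_le0.
    by have := tr_coproj_ge0 S Xp; rewrite lecE => /andP[].
  (* The multiples by [- 'i] and ['i] bound the imaginary part from both sides, so the value is
     real. *)
  have h2 : 0 <= re (trform (- 'i *: K) rho).
    by apply: re_trform_ge0 => // X Xp; rewrite LZ reN re_iM trim ?oppr0.
  have h3 : 0 <= re (trform (- (- 'i) *: K) rho).
    apply: re_trform_ge0 => // X Xp.
    by rewrite LZ mulNr reN reN re_iM trim ?oppr0.
  move: h2; rewrite trformZ re_iM => h2.
  move: h3; rewrite trformZ mulNr reN re_iM oppr_ge0 => h3.
  by rewrite lecE h1 andbT eq_le h2 h3.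
exists (trform K); split=> rho rhos; last first.
  move=> /(supported_stateE S rhos) Qrho; rewrite /= KL mulN1r oppr_lt0.
  by rewrite lt_neqAle eq_sym; apply/andP; split; [exact/eqP|case: rhos => /tr_coproj_ge0].
split; first exact: K0.
have [rhop _] := rhos.
rewrite (supported_stateE S rhos); split=> [/= Krho|/(tr_coproj_eq0 rhop) Qrho].
  (* A zero of the form is a minimum along its trajectory, so the derivative [- tr (Q rho)] at time
     0 is nonnegative. *)
  have D0 : 0 <= re (trform K (L rho)).
    apply: (is_derive_right_ge0 (is_derive_trform_flow0 H Cs K rho)) => s s0.
    have e0 : re (trform K (E 0 rho)) = 0.
      by rewrite (exp_flow0 L (trform K)) /= Krho.
    rewrite e0.
    by have := K0 _ (exp_flow_state Cs hH rhos s0); rewrite lecE => /andP[].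
  have Q0 := tr_coproj_ge0 S rhop.
  move: D0; rewrite KL mulN1r reN oppr_ge0.
  move: Q0; rewrite lecE => /andP[/eqP Qim Qre] Qre'.
  by apply/eqP; rewrite eq_complex/= Qim eqxx andbT eq_le Qre Qre'.
by rewrite /= Kb Qrho mul0mx /trform mulmx0 raddf0.
Qed.

End Lyapunov.

(* V is a linear form on all operators, i.e. the complex-linear extension of a
   linear function on states; [0 <= V rho] and [V _ < 0] in the order of R[i]
   include that the value is real. *)
Theorem theorem1p2 (R : realType) (d n : nat)
  (H : 'M[R[i]]_d) (hH : H \is hermsymmx) (C : 'I_n.+1 -> 'M[R[i]]_d)
  (S : {vspace 'cV[R[i]]_d}) :
  gas (lindblad H C) S <->
  exists V : {scalar 'M[R[i]]_d},
    (forall rho, is_state rho ->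
       0 <= V rho /\ (V rho = 0 <-> is_supported_state S rho)) /\
    (forall rho, is_state rho -> ~ is_supported_state S rho ->
       V (lindblad H C rho) < 0).
Proof.
split=> [[inv att]|[V [V1 V2]]]; first exact: gas_lyapunov.
by apply: (lyapunov_gas hH (V := V)) => // rho /V1[].
Qed.
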